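(* For any quadratic field $K/\mathbb{Q}$ with discriminant $D$ satisfying $-4000\leq D\leq 4000$, and any $c\in\mathbb{Q}$ satisfying $h(c)\leq 6\log 10$, the quadratic polynomial $\varphi_c(z)=z^2+c$ has no $K$-rational point with exact period greater than $6$.
   Context: For $c\in\mathbb{Q}$ put $\varphi_c(z)=z^2+c$, viewed as a self-map of $\mathbb{P}^1$ (the point at infinity is fixed). A point $\alpha\in\mathbb{P}^1(K)$ has exact period $n\geq 1$ for $\varphi_c$ if $\varphi_c^n(\alpha)=\alpha$ while $\varphi_c^m(\alpha)\neq\alpha$ for $0<m<n$, where $\varphi_c^n$ denotes the $n$-th iterate. The logarithmic height on $\mathbb{Q}$ is $h(p/q)=\log(\max(|p|,|q|))$ for integers $p,q$ with $q\neq 0$ and $\gcd(p,q)=1$. *)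

(* Defs.v *)
From HB Require Import structures.
From mathcomp Require Import all_boot all_order all_algebra all_field.
From mathcomp Require Import reals exp.
Set Implicit Arguments.
Unset Strict Implicit.
Unset Printing Implicit Defensive.
Import Order.TTheory GRing.Theory Num.Theory.
Local Open Scope ring_scope.

Definition log_height (R : realType) (c : rat) : R :=
  ln (Num.max `|numq c| `|denq c|)%:~R.

(* [option K] encodes P^1(K): [Some z] is the affine point z and [None] the
   point at infinity. *)
Definition phi (K : fieldExtType rat) (c : rat) : option K -> option K :=
  omap (fun z => z ^+ 2 + c%:A).

Definition has_exact_period (T : Type) (f : T -> T) (n : nat) (x : T) : Prop :=
  [/\ (0 < n)%N, iter n f x = x
    & forall m : nat, (0 < m < n)%N -> iter m f x <> x].

Definition quadratic_field (K : fieldExtType rat) : Prop :=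
  \dim {:K} = 2.

Definition field_trace (K : fieldExtType rat) (x : K) : rat :=
  \tr (passmx.mxof (vbasis {:K}) (vbasis {:K}) (amull x)).

(* [integralOver intr x]: x is a root of a monic polynomial over Z, that is,
   x lies in the ring of integers of K. *)
Definition integral_basis (K : fieldExtType rat) (b : (\dim {:K}).-tuple K) :
    Prop :=
  basis_of {:K} b /\
  forall x : K, integralOver (intr : int -> K) x <->
    exists a : 'I_(\dim {:K}) -> int, x = \sum_i (a i)%:~R * b`_i.

(* The discriminant of the trace form on an integral basis does not depend on
   the basis, so at most one D satisfies this for a given K. *)
Definition is_discriminant (K : fieldExtType rat) (D : int) : Prop :=
  exists b : (\dim {:K}).-tuple K, integral_basis b /\
    D%:~R = \det (\matrix_(i < \dim {:K}, j < \dim {:K})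
                   field_trace (b`_i * b`_j)).

(* Main.v *)
From Stdlib Require Import ZArith.
Require Import Defs.
From HB Require Import structures.
From mathcomp Require Import all_boot all_order all_algebra all_field.
From mathcomp Require Import reals exp.
From mathcomp Require Import ring lra zify ssrZ.
Set Implicit Arguments.
Unset Strict Implicit.
Unset Printing Implicit Defensive.
Import Order.TTheory GRing.Theory Num.Theory.
Local Open Scope ring_scope.

(** A point alpha of period n > 6 is studied through a companion point: its
    conjugate beta over Q when alpha is irrational, and beta = alpha^2 + c when
    alpha is rational.  In both cases the trace t = alpha + beta and the
    discriminant d = (alpha - beta)^2 are rational, and squaring-plus-c acts on
    them by
<<
      2 t' = t^2 + d + 4 c,        d' = t^2 d.
>>
    So the field disappears: what has to be understood is a periodic sequence
    (t_i, d_i) of pairs of rationals with d_i nonzero.  Since d is multiplied by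
    t^2 at each step, the product of the t_i over a period is 1 up to sign.

    Put C = 4 c and let p be any prime.  A p-adic growth argument gives
    |t_i|^2, |d_i| <= max(1, |C|) for the p-adic absolute value.  Hence
    all the t_i are p-adic units if |C| <= 1.  If |C| > 1, the first relation
    forces exactly one of |t_i|^2 = |C| and |d_i| = |C| at each i; when v_p(C) is
    odd only the second can hold, and the t_i are again units.  When |C| = q^2
    with q a power of p, the relation d' = t^2 d shows that q |t_i|^-1 = q^r with
    r = 0 in the first case, and with r = 1 + (number of consecutive indices of
    the first kind that follow) in the second.  If e is the product of
    these q, the numbers e t_i are therefore integers, equal up to sign to
    products of powers q^r whose exponents obey this strict pattern.  Moreover e^2
    divides the denominator of C, so the height bound on c gives e <= 1000,
    and the archimedean version of the growth argument bounds e t_i by a few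
    thousand.

    Three consecutive values of t determine the whole sequence: they give d_0 from
    d_0 (t_0^2 - 1) = t_0^2 - t_1^2 - 2 t_1 + 2 t_2, then C.  Starting just before
    |d| reaches its maximum, so that |t_0| > 1 >= |t_1| and |t_1 t_2| <= 1, there are
    about a hundred thousand triples (|t_0|, |t_1|, |t_2|) for e <= 1000; congruences
    modulo q cut them down to a few thousand.  A computation ([search_complete])
    extends each of them to t_3, t_4, ..., until some e t_i is not an integer of
    the required shape, or until t_i^2 and d_i take a value that they had
    at most three steps earlier.  The latter makes the sequence (t_i, d_i)
    periodic with period k <= 3 ([orbit_recurrent]); alpha - beta is then
    multiplied by +1 or -1 over k steps, so alpha has period at most 2 k <= 6
    ([short_period]), a contradiction. *)

(** * The p-adic absolute value on Q *)

Definition padic (p : nat) (x : rat) : rat :=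
  if x == 0 then 0
  else p%:R ^+ logn p `|denq x|%N / p%:R ^+ logn p `|numq x|%N.

Section Padic.
Variable p : nat.
Hypothesis p_prime : prime p.
Local Notation N := (padic p).
Let p_gt0 : 0 < p%:R :> rat.
Proof. by rewrite ltr0n prime_gt0. Qed.
Let p_gt1 : 1 < p%:R :> rat.
Proof. by rewrite ltr1n prime_gt1. Qed.

Lemma padic_frac (n d : int) : n != 0 -> d != 0 ->
  N (n%:~R / d%:~R) = p%:R ^+ logn p `|d|%N / p%:R ^+ logn p `|n|%N.
Proof.
move=> n0 d0; set x : rat := n%:~R / d%:~R.
have x0 : x != 0 by rewrite mulf_neq0 ?invr_eq0 ?intr_eq0.
rewrite /padic (negPf x0).
apply/eqP; rewrite eqr_div ?expf_neq0 ?lt0r_neq0 // -!exprD; apply/eqP; congr (_ ^+ _).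
have nx0 : numq x != 0 by rewrite numq_eq0.
have dx0 : denq x != 0 by rewrite denq_eq0.
rewrite -!lognM ?absz_gt0 // -!abszM; congr (logn p (absz _)).
apply/eqP; rewrite -(eqr_int rat) !intrM; apply/eqP.
have /eqP := divq_num_den x; rewrite {3}/x eqr_div ?intr_eq0 // => /eqP e.
by rewrite mulrC -e mulrC.
Qed.

Lemma padic0 : N 0 = 0. Proof. by rewrite /padic eqxx. Qed.

Lemma padic_gt0 x : x != 0 -> 0 < N x.
Proof. by move=> x0; rewrite /padic (negPf x0) divr_gt0 ?exprn_gt0. Qed.

Lemma padic_ge0 x : 0 <= N x.
Proof. by have [->|/padic_gt0/ltW//] := eqVneq x 0; rewrite padic0. Qed.

Lemma padic_int (n : int) : n != 0 -> N n%:~R = (p%:R ^+ logn p `|n|%N)^-1.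
Proof.
by move=> n0; rewrite -[n%:~R]divr1 -[1]/(1%:~R) padic_frac // logn1 expr0 div1r.
Qed.

Lemma padic1 : N 1 = 1.
Proof. by rewrite -[1]/(1%:~R) padic_int // logn1 expr0 invr1. Qed.

Lemma padicM x y : N (x * y) = N x * N y.
Proof.
have [->|x0] := eqVneq x 0; first by rewrite mul0r padic0 mul0r.
have [->|y0] := eqVneq y 0; first by rewrite mulr0 padic0 mulr0.
rewrite -(divq_num_den x) -(divq_num_den y) mulf_div -!intrM !padic_frac
  ?mulf_neq0 ?numq_eq0 ?denq_eq0 // !abszM !lognM ?absz_gt0 ?numq_eq0 ?denq_eq0 //.
by rewrite !exprD mulf_div.
Qed.

Lemma padicX x k : N (x ^+ k) = N x ^+ k.
Proof. by elim: k => [|k IH]; rewrite ?padic1 // !exprS padicM IH. Qed.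

Lemma padicN x : N (- x) = N x.
Proof.
rewrite -mulN1r padicM; have -> : N (-1) = 1; last by rewrite mul1r.
by rewrite -[-1]/((-1)%:~R) padic_int // logn1 expr0 invr1.
Qed.

Lemma padic_prod (I : Type) (r : seq I) (F : I -> rat) :
  N (\prod_(i <- r) F i) = \prod_(i <- r) N (F i).
Proof.
apply: (big_morph N _ _); [exact: padicM | exact: padic1].
Qed.

Lemma padic_int_le (k : nat) (n : int) :
  (N n%:~R <= p%:R ^- k) = (p ^ k %| `|n|)%N.
Proof.
have [->|n0] := eqVneq n 0.
  by rewrite padic0 dvdn0 invr_ge0 exprn_ge0 // ltW.
rewrite padic_int // lef_pV2 ?posrE ?exprn_gt0 // ler_eXn2l //.
by rewrite pfactor_dvdn // absz_gt0.
Qed.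

Lemma padicD x y : N (x + y) <= Num.max (N x) (N y).
Proof.
have [->|x0] := eqVneq x 0; first by rewrite add0r le_max lexx orbT.
have [->|y0] := eqVneq y 0; first by rewrite addr0 le_max lexx.
wlog le_yx : x y x0 y0 / N y <= N x.
  move=> H; have [le|/ltW le] := leP (N y) (N x); last first.
    by rewrite addrC; apply: le_trans (H _ _ y0 x0 le) _; rewrite ge_max le lexx.
  by apply: le_trans (H _ _ x0 y0 le) _; rewrite ge_max le lexx.
rewrite le_max; apply/orP; left.
have -> : x + y = x * (1 + y / x) by rewrite mulrDr mulr1 mulrC divfK.
rewrite padicM ger_pMr ?padic_gt0 //.
have : N (y / x) <= 1.
  by rewrite -(ler_pM2r (padic_gt0 x0)) -padicM divfK // mul1r.
move: (y / x) => z; have [->|z0] := eqVneq z 0; first by rewrite addr0 padic1.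
have [->|z1] := eqVneq (1 + z) 0; first by rewrite padic0 ler01.
rewrite -(divq_num_den z).
have den0 : denq z != 0 by rewrite denq_eq0.
have -> : 1 + (numq z)%:~R / (denq z)%:~R
          = (denq z + numq z)%:~R / (denq z)%:~R :> rat.
  by rewrite intrD mulrDl divff // intr_eq0.
have s0 : denq z + numq z != 0.
  rewrite -(intr_eq0 rat) intrD; apply: contra z1 => /eqP e.
  have d0 : (denq z)%:~R != 0 :> rat by rewrite intr_eq0.
  have -> : 1 + z = ((denq z)%:~R + (numq z)%:~R) / (denq z)%:~R.
    by rewrite mulrDl divff // divq_num_den.
  by rewrite e mul0r.
rewrite !padic_frac ?numq_eq0 // !ler_pdivrMr ?exprn_gt0 // !mul1r !ler_eXn2l // => le.
rewrite -pfactor_dvdn ?absz_gt0 //.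
have : (p ^ logn p `|denq z| %| `|numq z|)%N by rewrite pfactor_dvdn ?absz_gt0 ?numq_eq0.
have : (p ^ logn p `|denq z| %| `|denq z|)%N by rewrite pfactor_dvdnn.
by move: (p ^ _)%N => k; rewrite -[k]/(absz k%:Z) -!dvdzE => h1 h2; exact: rpredD.
Qed.

Lemma padicD_le x y b : N x <= b -> N y <= b -> N (x + y) <= b.
Proof. by move=> xb yb; apply: le_trans (padicD _ _) _; rewrite ge_max xb yb. Qed.

Lemma padicB_le x y b : N x <= b -> N y <= b -> N (x - y) <= b.
Proof. by move=> xb yb; rewrite padicD_le ?padicN. Qed.

Lemma padicD_lt x y : N x < N y -> N (x + y) = N y.
Proof.
move=> xy; apply/le_anti/andP; split; first by rewrite padicD_le // ltW.
rewrite leNgt; apply/negP => lt.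
have := padicD (x + y) (- x); rewrite addrC addKr padicN leNgt gt_max.
by rewrite lt xy.
Qed.

Lemma padic2_le1 : N 2 <= 1.
Proof. by rewrite -[2]/(2%:~R) -[1]invr1 -(expr0 p%:R) padic_int_le expn0 dvd1n. Qed.

End Padic.

(** * Periodic sequences of traces and discriminants *)

(** The growth principle used at every place: a quantity that increases as soon as
    it has entered an upward closed set of values cannot enter it periodically. *)
Lemma periodic_no_escape (n : nat) (g : nat -> rat) (P : rat -> Prop) :
    (0 < n)%N -> (forall i, g (i + n)%N = g i) ->
    (forall x y, P x -> x < y -> P y) -> (forall i, P (g i) -> g i < g i.+1) ->
  forall i, ~ P (g i).
Proof.
move=> n0 gn Pup gS i Pi.
have H k : g i < g (i + k.+1)%N /\ P (g (i + k.+1)%N).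
  elim: k => [|k [lt Pk]].
    by have lt := gS _ Pi; rewrite addn1; split=> //; exact: Pup Pi lt.
  have lt' := gS _ Pk; rewrite addnS; split; first exact: lt_trans lt'.
  exact: Pup Pk lt'.
by have [+ _] := H n.-1; rewrite prednK // gn ltxx.
Qed.

Lemma periodic_nonincreasing (n : nat) (g : nat -> rat) :
    (0 < n)%N -> (forall i, g (i + n)%N = g i) -> (forall i, g i.+1 <= g i) ->
  forall i, g i.+1 = g i.
Proof.
move=> n0 gn gS i; apply/le_anti; rewrite gS /= -[leLHS]gn -(prednK n0).
elim: n.-1 => [|k IH]; first by rewrite addn1.
by rewrite addnS; apply: le_trans IH.
Qed.

(** The pattern of the exponents at a prime: a positive exponent r + 1 announces
    that exactly the next r exponents vanish. *)
Definition blocky (f : nat -> nat) : Prop :=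
  forall i r, f i = r.+1 ->
    (forall j, (0 < j <= r)%N -> f (i + j)%N = 0%N) /\ (0 < f (i + r.+1)%N)%N.

Section Orbit.
Variables (C : rat) (n : nat) (t d : nat -> rat).
Hypotheses (n_gt0 : (0 < n)%N) (d0_neq0 : d 0%N != 0).
Hypothesis tS : forall i, 2 * t i.+1 = t i ^+ 2 + d i + C.
Hypothesis dS : forall i, d i.+1 = t i ^+ 2 * d i.
Hypothesis t_per : forall i, t (i + n)%N = t i.
Hypothesis d_per : forall i, d (i + n)%N = d i.

Lemma d_prod i k : d (i + k)%N = (\prod_(j < k) t (i + j)%N) ^+ 2 * d i.
Proof.
elim: k => [|k IH]; first by rewrite addn0 big_ord0 expr1n mul1r.
by rewrite addnS dS IH big_ord_recr /= exprMn mulrCA mulrA.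
Qed.

Lemma d_neq0 i : d i != 0.
Proof.
have : d (i * n)%N = d 0%N by elim: i => [|i IH] //; rewrite mulSn addnC d_per.
apply: contra_eq_neq => di0.
have /subnKC <- : (i <= i * n)%N by rewrite leq_pmulr.
by rewrite d_prod di0 mulr0 eq_sym.
Qed.

Lemma t_neq0 i : t i != 0.
Proof. by apply: contra (d_neq0 i.+1) => /eqP ti; rewrite dS ti expr0n mul0r. Qed.

(** For g = max(t^2, |d|) large, g grows: either t^2 and |d| both exceed 1 and
    their product is the next |d|, or one of them is at most 1 and the next t is
    close to g / 2.  The bound is the threshold (sqrt g - 1)^2 <= |C| + 2 beyond
    which g / 2 beats sqrt g, written without square roots. *)
Lemma t_archimedean i : (`|t i| - 1) ^+ 2 <= `|C| + 2.
Proof.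
pose P x := 1 + `|C| < x /\ 4 * x < (x - 1 - `|C|) ^+ 2.
have Cge : 0 <= `|C| := normr_ge0 C.
have Pup x y : P x -> x < y -> P y.
  move=> [xC x4] xy; split; first exact: lt_trans xy.
  have : 2 < x - 1 - `|C| by nra.
  by nra.
pose g j := Num.max (t j ^+ 2) `|d j|.
have gS j : P (g j) -> g j < g j.+1.
  rewrite /g dS normrM ger0_norm ?sqr_ge0 //.
  have tj := sqr_ge0 (t j); have dj := normr_ge0 (d j).
  move: (tS j); move: (t j.+1) => t' e.
  have [m1|m1] := ltP 1 (Num.min (t j ^+ 2) `|d j|).
    move=> _; rewrite lt_max; apply/orP; right.
    move: m1; rewrite lt_min => /andP[] t1 d1.
    by have [le|le] := leP (t j ^+ 2) `|d j|; nra.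
  case=> gC g4; rewrite lt_max; apply/orP; left.
  have : g j - 1 - `|C| <= `|2 * t'|.
    have : `|C| >= C by exact: ler_norm.
    have : `|C| >= - C by rewrite -normrN ler_norm.
    rewrite e; move: m1; rewrite /g.
    have [le|le] := leP (t j ^+ 2) `|d j| => m1.
      by case: (ger0P (d j)) le m1 => hd le m1;
         case: (ger0P (t j ^+ 2 + d j + C)) => hs; lra.
    move: m1; case: (ger0P (d j)) le => hd le m1;
      case: (ger0P (t j ^+ 2 + d j + C)) => hs; lra.
  rewrite -/(g j) => le; have : (2 * t') ^+ 2 >= (g j - 1 - `|C|) ^+ 2.
    rewrite -[(2 * t') ^+ 2]real_normK ?num_real //.
    by apply: lerXn2r; rewrite ?nnegrE ?normr_ge0 //; rewrite -/(g j) in gC *; lra.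
  by rewrite -/(g j) in g4 *; lra.
have gn j : g (j + n)%N = g j by rewrite /g t_per d_per.
have nP := periodic_no_escape n_gt0 gn Pup gS.
have tg : t i ^+ 2 <= g i by rewrite /g le_max lexx.
have {nP} : ~ P (t i ^+ 2).
  move: tg; rewrite le_eqVlt => /orP[/eqP->|lt PP]; first exact: nP.
  exact: (nP i (Pup _ _ PP lt)).
rewrite -(real_normK (num_real (t i))); move: (normr_ge0 (t i)); move: `|t i| => y y0 nP.
case: (ltP (1 + `|C|) (y ^+ 2)) => h1; last by nra.
case: (ltP (4 * y ^+ 2) ((y ^+ 2 - 1 - `|C|) ^+ 2)) => h2; first by case: nP.
have : y ^+ 2 - 1 - `|C| <= 2 * y by nra.
by lra.
Qed.

Section Local.
Variable p : nat.
Hypothesis p_prime : prime p.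
Local Notation N := (padic p).

Let N_gt0 x : x != 0 -> 0 < N x := padic_gt0 p_prime (x:=x).
Let N_ge0 x : 0 <= N x := padic_ge0 p_prime x.

Let N_dS i : N (d i.+1) = N (t i) ^+ 2 * N (d i).
Proof. by rewrite dS padicM // padicX. Qed.

(** Above max(1, |C|) the larger g of |t|^2 and |d| is at least squared in one step:
    if they differ, C is negligible and |2 t'| = g; if they agree, |d'| = g^2. *)
Lemma padic_orbit_le i :
  N (t i) ^+ 2 <= Num.max 1 (N C) /\ N (d i) <= Num.max 1 (N C).
Proof.
set Q := Num.max _ _.
pose g j := Num.max (N (t j) ^+ 2) (N (d j)).
suff : ~ (Q < g i) by move/negP; rewrite -leNgt /g ge_max => /andP.
have gn j : g (j + n)%N = g j by rewrite /g t_per d_per.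
apply: (periodic_no_escape (P := fun x => Q < x) n_gt0 gn) => [x y|j].
  exact: lt_trans.
have Q1 : 1 <= Q by rewrite /Q le_max lexx.
have QC : N C <= Q by rewrite /Q le_max lexx orbT.
rewrite /g N_dS -padicX //.
move: (N_ge0 (t j ^+ 2)) (N_ge0 (d j)) => t0 d0.
have [eqtd lt|ne lt] := eqVneq (N (t j ^+ 2)) (N (d j)).
  move: lt; rewrite eqtd maxxx => lt; rewrite lt_max; apply/orP; right; nra.
rewrite lt_max; apply/orP; left.
have e : N (t j ^+ 2 + d j + C) = Num.max (N (t j ^+ 2)) (N (d j)).
  have e' : N (t j ^+ 2 + d j) = Num.max (N (t j ^+ 2)) (N (d j)).
    by case: (ltgtP (N (t j ^+ 2)) (N (d j))) ne => // h _;
       [|rewrite addrC]; exact: padicD_lt.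
  by rewrite addrC -e' padicD_lt // e'; apply: le_lt_trans lt.
rewrite -e -tS padicM // in lt *; move: lt Q1.
move: (padic2_le1 p_prime) (N_ge0 2) (N_ge0 (t j.+1)).
move: (N 2) (N (t j.+1)) => a b a1 a0 b0 lt Q1.
have ab : a * b <= b by nra.
have : 1 < b by lra.
nra.
Qed.

(** If no t_i has a pole at p then |d_i| does not increase, hence is constant by
    periodicity. *)
Lemma padic_t_unit : (forall i, N (t i) <= 1) -> forall i, N (t i) = 1.
Proof.
move=> le1 i.
have gn j : N (d (j + n)%N) = N (d j) by rewrite d_per.
have gS j : N (d j.+1) <= N (d j).
  by rewrite N_dS ger_pMl ?N_gt0 ?d_neq0 // expr_le1.
have := periodic_nonincreasing n_gt0 gn gS i; rewrite N_dS.
move/eqP; rewrite -subr_eq0 -{2}[N (d i)]mul1r -mulrBl mulf_eq0 subr_eq0.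
rewrite (gt_eqF (N_gt0 (d_neq0 i))) orbF sqrf_eq1 => /orP[/eqP//|/eqP e].
by have h := N_ge0 (t i); rewrite e in h; lra.
Qed.

Lemma padic_t_unit_integral : N C <= 1 -> forall i, N (t i) = 1.
Proof.
move=> C1; apply: padic_t_unit => i; have [] := padic_orbit_le i.
by rewrite max_l // expr_le1.
Qed.

Section Pole.
Hypothesis C_gt1 : 1 < N C.
Local Notation Q := (N C).

Let t_leQ i : N (t i) ^+ 2 <= Q.
Proof. by have [] := padic_orbit_le i; rewrite max_r // ltW. Qed.
Let d_leQ i : N (d i) <= Q.
Proof. by have [_] := padic_orbit_le i; rewrite max_r // ltW. Qed.

(** Both equalities together would give |d'| = |C|^2 > |C|; neither of them would
    leave |2 t'| = |C|, too large for t'. *)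
Lemma padic_dichotomy i : (N (t i) ^+ 2 == Q) = (N (d i) != Q).
Proof.
have tQ := t_leQ i; have dQ := d_leQ i.
have [dE|dN] := eqVneq (N (d i)) Q; apply/eqP.
  move=> tE; have := d_leQ i.+1; rewrite N_dS tE dE leNgt => /negP; apply.
  by rewrite ltr_pMr // (lt_trans ltr01).
apply: contraNeq dN => tN.
apply/eqP/le_anti; rewrite dQ /= leNgt; apply/negP => dlt.
have tlt : N (t i ^+ 2) < Q by rewrite padicX // lt_neqAle tN.
have : N (2 * t i.+1) = Q.
  rewrite tS padicD_lt //.
  by apply: le_lt_trans (padicD p_prime _ _) _; rewrite gt_max tlt.
rewrite padicM //; move: (t_leQ i.+1) (padic2_le1 p_prime) C_gt1.
move: (N_ge0 2) (N_ge0 (t i.+1)); move: (N 2) (N (t i.+1)) Q => a b q a0 b0 b2 a1 q1 e.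
have : a * b <= b by nra.
nra.
Qed.

Lemma padic_t_same i : N (d i) != Q -> N (t i) ^+ 2 = Q.
Proof. by rewrite -padic_dichotomy => /eqP. Qed.

Lemma padic_d_same_le1 i : N (d i) != Q -> N (d i) <= 1.
Proof.
move/padic_t_same => e; have := d_leQ i.+1; rewrite N_dS e.
by rewrite ger_pMr // (lt_trans ltr01).
Qed.

Lemma padic_t_opp_le1 i : N (d i) = Q -> N (t i) ^+ 2 <= 1.
Proof.
move=> e; have := d_leQ i.+1; rewrite N_dS e.
by rewrite ger_pMl // (lt_trans ltr01).
Qed.

Lemma padic_t_unit_opp : (forall i, N (d i) = Q) -> forall i, N (t i) = 1.
Proof.
move=> opp; apply: padic_t_unit => i.
by have := padic_t_opp_le1 (opp i); rewrite expr_le1.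
Qed.

(** Otherwise |d| would be multiplied by |C| > 1 at every step. *)
Lemma padic_opp_after i : exists r, N (d (i + r.+1)%N) == Q.
Proof.
have [/existsP[j jQ]|/existsPn no] := boolP [exists j : 'I_n, N (d (i + j.+1)%N) == Q].
  by exists j.
have H k : (k < n)%N -> N (d i.+1) < N (d (i.+1 + k.+1)%N).
  have step j : (j < n)%N -> N (d (i.+1 + j)%N) < N (d (i.+1 + j.+1)%N).
    move=> jn; rewrite addnS N_dS (padic_t_same (i := (i.+1 + j)%N)).
      by rewrite ltr_pMl ?N_gt0 ?d_neq0.
    by have := no (Ordinal jn); rewrite /= addSnnS.
  elim: k => [|k IH] kn; first by have := step 0%N kn; rewrite addn0.
  by apply: lt_trans (IH (ltnW kn)) _; exact: step.
by have := H n.-1; rewrite prednK // d_per ltxx leqnn => /(_ isT).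
Qed.

(** The exponent r for which |t_i| = q^(1 - r), see [padic_t_exponent]. *)
Definition exponent i : nat :=
  if N (d i) == Q then (ex_minn (padic_opp_after i)).+1 else 0.

Lemma exponent_eq0 i : (exponent i == 0%N) = (N (d i) != Q).
Proof. by rewrite /exponent; case: (N (d i) == Q). Qed.

Lemma exponent_blocky : blocky exponent.
Proof.
move=> i r; rewrite {1}/exponent; case: (N (d i) == Q) => // -[].
case: ex_minnP => m mQ mmin <-; split; last by rewrite lt0n exponent_eq0 negbK.
move=> j /andP[j0 jm]; apply/eqP; rewrite exponent_eq0; apply/negP => jQ.
by have := mmin j.-1; rewrite prednK // jQ => /(_ isT); lia.
Qed.

Variable q : rat.
Hypotheses (q_gt0 : 0 < q) (CE : N C = q ^+ 2).

Let t_same i : exponent i = 0%N -> N (t i) = q.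
Proof.
move/eqP; rewrite exponent_eq0 => /padic_t_same; rewrite CE => /eqP.
rewrite eqf_sqr => /orP[/eqP//|/eqP e].
by have h := N_ge0 (t i); have h0 := q_gt0; rewrite e in h; lra.
Qed.

(** Between two consecutive indices with |d| = |C| the product of the t_j has
    absolute value 1, and all the factors but the first have absolute value q. *)
Lemma padic_t_exponent i : N (t i) * q ^+ exponent i = q.
Proof.
case e : (exponent i) => [|r]; first by rewrite mulr1; exact: t_same.
have [zero next] := exponent_blocky e.
have iQ : N (d i) == Q by rewrite -[_ == _]negbK -exponent_eq0 e.
have jQ : N (d (i + r.+1)%N) == Q by rewrite -[_ == _]negbK -exponent_eq0 -lt0n.
have := d_prod i r.+1; move/(congr1 N).
rewrite padicM // padicX // (eqP iQ) (eqP jQ) -{1}[Q]mul1r.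
move/(mulIf (lt0r_neq0 (lt_trans ltr01 C_gt1)))/esym/eqP.
rewrite padic_prod // big_ord_recl addn0 /=.
rewrite (eq_bigr (fun=> q)) => [|j _]; last first.
  by apply: t_same; apply: zero; case: j => /= j; rewrite /bump /=; lia.
rewrite prodr_const card_ord sqrf_eq1 => /orP[]/eqP e1.
  by rewrite exprSr mulrA e1 mul1r.
have : 0 <= N (t i) * q ^+ r by rewrite mulr_ge0 ?N_ge0 // exprn_ge0 // ltW.
by rewrite e1 => ?; lra.
Qed.

(* True at odd p because |2| = 1, and at p = 2 because q is a positive power of 2. *)
Hypothesis q_ge : 1 <= N 2 * q.

Let N2t i : N (2 * t i) <= N 2 * q.
Proof.
rewrite padicM // ler_wpM2l ?N_ge0 //.
by have := t_leQ i; rewrite CE ler_sqr ?nnegrE ?N_ge0 // ltW.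
Qed.

(** When |t_i| = q is large, d_i is integral and t_i^2 is close to -C. *)
Lemma padic_same_congr i j : exponent i = 0%N -> exponent j = 0%N ->
  N (t i ^+ 2 - t j ^+ 2) <= N 2 * q.
Proof.
have H k : exponent k = 0%N -> N (t k ^+ 2 + C) <= N 2 * q.
  move/eqP; rewrite exponent_eq0 => /padic_d_same_le1 dk.
  have -> : t k ^+ 2 + C = 2 * t k.+1 - d k by rewrite tS; ring.
  by rewrite padicB_le // (le_trans dk).
move=> /H Hi /H Hj.
have -> : t i ^+ 2 - t j ^+ 2 = (t i ^+ 2 + C) - (t j ^+ 2 + C) by ring.
exact: padicB_le.
Qed.

(** When |d| = |C|, t is integral and d is close to -C, so that the ratio of two
    such values of d is close to 1; that ratio is a square of a product of t's. *)
Lemma padic_block_congr i r : exponent i = r.+1 ->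
  N ((\prod_(j < r.+1) t (i + j)%N) ^+ 2 - 1) * q <= N 2.
Proof.
move=> e; have [_ next] := exponent_blocky e.
have iQ : N (d i) == Q by rewrite -[_ == _]negbK -exponent_eq0 e.
have jQ : N (d (i + r.+1)%N) == Q by rewrite -[_ == _]negbK -exponent_eq0 -lt0n.
have H k : N (d k) == Q -> N (d k + C) <= N 2 * q.
  move/eqP/padic_t_opp_le1 => tk.
  have -> : d k + C = 2 * t k.+1 - t k ^+ 2 by rewrite tS; ring.
  by rewrite padicB_le // padicX // (le_trans tk).
have : N (d (i + r.+1)%N - d i) <= N 2 * q.
  have -> : d (i + r.+1)%N - d i = (d (i + r.+1)%N + C) - (d i + C) by ring.
  by rewrite padicB_le // H.
rewrite d_prod -{2}[d i]mul1r -mulrBl padicM // (eqP iQ) CE expr2 mulrA.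
by rewrite ler_pM2r.
Qed.

End Pole.
End Local.
End Orbit.

(** * The search *)
Section Search.
Local Open Scope Z_scope.

(** The part q = p^k of e at a prime p, and the modulus m of the congruences at p:
    m = q for odd p, m = 2 q for p = 2. *)
Definition modulus := (Z * Z)%type.
(** The exponents at a prime met so far, the most recent one first. *)
Definition cell := (modulus * seq nat)%type.

(** [Some r] means that the next r exponents are 0 and that the one after them is
    positive.  Histories of length at most two are enough for windows of three
    terms. *)
Definition forced (h : seq nat) : option nat :=
  match h with
  | r.+1 :: _ => Some r
  | 0%N :: r.+2 :: _ => Some r
  | _ => None
  end.

Section Powers.
Variable rest : Z -> seq (Z * seq cell).
(** Multiplies the products found at the remaining primes by q^r, q^(r+1), ... as
    long as the result stays within [lim]; [qr] is q^r. *)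
Fixpoint powers (fuel r : nat) (qm : modulus) (h : seq nat) (qr lim : Z) :
    seq (Z * seq cell) :=
  if fuel is fuel'.+1 then
    if lim <? qr then [::] else
    [seq (qr * y.1, (qm, r :: h) :: y.2) | y <- rest (lim / qr)]
      ++ powers fuel' r.+1 qm h (qr * qm.1) lim
  else [::].
End Powers.

(** All the values up to [lim] that the next e |t_i| can take, each with the
    updated histories.  Exponents stay below 12 since [lim] is below 4096. *)
Fixpoint rows (cs : seq cell) (lim : Z) {struct cs} : seq (Z * seq cell) :=
  if cs is (qm, h) :: cs' then
    let zero := [seq (y.1, (qm, 0%N :: h) :: y.2) | y <- rows cs' lim] in
    let pos := powers (rows cs') 12 1 qm h qm.1 lim in
    match forced h with
    | Some 0%N => pos
    | Some _ => zero
    | None => zero ++ pos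
    end
  else [:: (1, [::])].

Definition divides (d x : Z) : bool := x mod d =? 0.

(** [sq] lists the squares (e t_i)^2, the most recent one first, and [E2] is e^2.
    The tests are instances of [padic_same_congr], and of [padic_block_congr] for
    blocks of length 1 and 2; they discard most of the candidates before any sign
    has to be chosen. *)
Definition congruent (E2 : Z) (sq : seq Z) (c : cell) : bool :=
  let '(q, m, h) := c in
  match h with
  | 1%N :: _ => if sq is s :: _ then divides (m * (q * q)) (s - E2) else true
  | 0%N :: 2%N :: _ =>
      if sq is [:: s, s' & _] then divides (m * (q * q * (q * q))) (s * s' - E2 * E2)
      else true
  | 0%N :: 0%N :: _ => if sq is [:: s, s' & _] then divides m (s - s') else true
  | 0%N :: _ :: 0%N :: _ => if sq is [:: s, _, s' & _] then divides m (s - s') else true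
  | _ => true
  end.

Definition same_abs (x y : Z) : bool := Z.abs x =? Z.abs y.

(** Has the pair (t^2, d) come back after 1, 2 or 3 steps?  For d this reads on the
    product of the t_i in between. *)
Definition recurs (E : Z) (l : seq Z) : bool :=
  match l with
  | x :: y :: l' =>
    [|| same_abs x y && same_abs y E |
    match l' with
    | z :: l'' =>
      [|| same_abs x z && same_abs (y * z) (E * E) |
      match l'' with
      | w :: _ => same_abs x w && same_abs (y * z * w) (E * E * E)
      | _ => false
      end]
    | _ => false
    end]
  | _ => false
  end.

(** Computes the successive T_i = e t_i through
<<
      2 e (T_(j+1) - T_1) e^(2j-2) D0
        = (T_j^2 - T_0^2) e^(2j-2) D0 + N0 (P^2 - e^(2j)),
>>
    where P = T_0 ... T_(j-1), D0 = T_0^2 - e^2 and N0 = d_0 D0.  Here [a] = T_0,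
    [b] = T_1, [x] = T_j, [Ej] = e^(2j-2), and [l] lists T_j, ..., T_0.  The answer
    is [true] when the sequence recurs or cannot be continued: a division is not
    exact, a term exceeds [lim], or it does not divide e^12 as every admissible
    term does.  As T_0 only enters through its square, [a] may be taken positive. *)
Fixpoint continue (fuel : nat) (E E12 lim a b N0 D0 P Ej x : Z) (l : seq Z) : bool :=
  if fuel is fuel'.+1 then
    if recurs E l then true else
    let den := Ej * D0 in
    let num := N0 * (P * P - Ej * E * E) in
    if ~~ divides den num then true else
    let y := x * x - a * a + num / den in
    if ~~ divides (2 * E) y then true else
    let x' := y / (2 * E) + b in
    if lim <? Z.abs x' then true else
    if ~~ divides x' E12 then true else
    continue fuel' E E12 lim a b N0 D0 (P * x) (Ej * E * E) x' (x' :: l)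
  else false.

Definition height_bound : Z := 1000000.

(** From (|t| - 1)^2 <= |C| + 2, as e^2 |C| is at most the numerator of C = 4 c.
    For even e the denominator of C is even, so that the factor 4 is absorbed by
    the denominator of c and the numerators of C and c are equal. *)
Definition bound (e : nat) : Z :=
  let E := Z.of_nat e in
  E + Z.sqrt ((if odd e then 4 * height_bound else height_bound) + 2 * (E * E)).

Lemma bound_lt4096 e : (e <= 1000)%N -> bound e < 4096.
Proof.
move=> e1000; rewrite /bound /height_bound; set s := (_ + 2 * _).
have : Z.sqrt s <= Z.sqrt 6000000.
  by apply: Z.sqrt_le_mono; rewrite /s; case: (odd e); nia.
have -> : Z.sqrt 6000000 = 2449 by [].
lia.
Qed.

Definition prime_modulus (pk : nat * nat) : modulus :=
  let q := Z.of_nat (pk.1 ^ pk.2) in (q, if pk.1 == 2%N then 2 * q else q).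

(** The window is |T_0| > e >= |T_1| and |T_1 T_2| <= e^2.  The absolute values are
    chosen one after the other, and the signs of T_1 and T_2 last. *)
Definition try_signs (E lim a b c : Z) : bool :=
  let N0 := a * a - b * b - 2 * E * b + 2 * E * c in
  if N0 =? 0 then true else
  continue 10 E (E ^ 12) lim a b N0 (a * a - E * E) (a * b) (E * E) c [:: c; b; a].

Definition try_third (E lim a b : Z) (rc : Z * seq cell) : bool :=
  let c := rc.1 in
  if ~~ all (congruent (E * E) [:: c * c; b * b; a * a]) rc.2 then true else
  if recurs E [:: c; b; a] then true else
  all (fun b' => all (try_signs E lim a b') [:: c; - c]) [:: b; - b].

Definition try_second (E lim a : Z) (rb : Z * seq cell) : bool :=
  let b := rb.1 in
  if ~~ all (congruent (E * E) [:: b * b; a * a]) rb.2 then true else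
  all (try_third E lim a b) (rows rb.2 (Z.min lim (E * E / b))).

Definition try_first (E lim : Z) (ra : Z * seq cell) : bool :=
  let a := ra.1 in
  if a <=? E then true else
  if ~~ all (congruent (E * E) [:: a * a]) ra.2 then true else
  all (try_second E lim a) (rows ra.2 E).

(** For even e the denominator of c is at least (2 e)^2, whence the bound 500. *)
Definition search (e : nat) : bool :=
  if ~~ odd e && (500 < e)%N then true else
  all (try_first (Z.of_nat e) (bound e))
    (rows [seq (prime_modulus pk, [::]) | pk <- prime_decomp e] (bound e)).
End Search.

Lemma search_complete : all search (iota 1 1000).
Proof. by vm_compute. Qed.

Lemma search_holds e : (0 < e <= 1000)%N -> search e.
Proof.
by move=> /andP[e0 e1000]; apply: (allP search_complete); rewrite mem_iota e0 add1n ltnS.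
Qed.

(** * Soundness of the search *)
Fixpoint hist (A : Type) (f : nat -> A) (k : nat) : seq A :=
  if k is k'.+1 then f k' :: hist f k' else [::].

Lemma forced_sound f k : blocky f ->
  match forced (hist f k) return Prop with
  | Some 0 => (0 < f k)%N
  | Some _ => f k = 0%N
  | None => True
  end.
Proof.
move=> fB; case: k => [//|k] /=.
case fk: (f k) => [|r] /=.
  case: k fk => [//|k] /= _; case fk: (f k) => [//|[//|r]] /=.
  have [zero next] := fB _ _ fk.
  case: r zero next {fk} => [|r] zero next; first by rewrite addn2 in next.
  by have := zero 2%N isT; rewrite addn2.
have [zero next] := fB _ _ fk; case: r zero next {fk} => [|r] zero next.
  by rewrite addn1 in next.
by have := zero 1%N isT; rewrite addn1.
Qed.

Lemma dividesI (d x y : Z) : x = d * y -> divides d x.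
Proof.
move=> ->; rewrite /divides; apply/Z.eqb_eq.
case: (Z.eq_dec d 0) => [->|d0]; first by case: y.
by rewrite -[GRing.mul d y]/(Z.mul d y) Z.mul_comm Z.mod_mul.
Qed.

Lemma powers_sound rest fuel r k qm h lim X y :
    (2 <= qm.1) -> (r <= k < r + fuel)%N -> 1 <= X -> qm.1 ^+ k * X <= lim ->
    (X, y) \in rest (Z.div lim (qm.1 ^+ k)) ->
  (qm.1 ^+ k * X, (qm, k :: h) :: y) \in powers rest fuel r qm h (qm.1 ^+ r) lim.
Proof.
move=> q2; elim: fuel r => [|fuel IH] r /andP[rk kr] X1 Xlim Xy; first by lia.
rewrite /=.
have q1 : 1 <= qm.1 by lia.
have le : qm.1 ^+ r <= qm.1 ^+ k by rewrite ler_weXn2l.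
have kpos : 1 <= qm.1 ^+ k by rewrite exprn_ege1.
have -> : Z.ltb lim (qm.1 ^+ r) = false by nia.
rewrite mem_cat; apply/orP; move: rk; rewrite leq_eqVlt => /orP[/eqP->|rk]; [left|right].
  by apply/mapP; exists (X, y).
rewrite -[Z.mul _ _]/(qm.1 ^+ r * qm.1)%R -exprSr; apply: IH => //; lia.
Qed.

Arguments powers : simpl never.

Section Sound.
Variable T : nat -> Z.
Variable E : Z.

(** For each prime dividing e, its modulus and the sequence of its exponents. *)
Definition system := seq (modulus * (nat -> nat)).

Definition cells (fs : system) (k : nat) : seq cell :=
  [seq (f.1, hist f.2 k) | f <- fs].

Definition row (fs : system) (k : nat) : Z := \prod_(f <- fs) f.1.1 ^+ f.2 k.

Lemma row_ge1 (fs : system) k :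
  (forall f, List.In f fs -> 2 <= f.1.1 /\ blocky f.2) -> 1 <= row fs k.
Proof.
rewrite /row; elim: fs => [|f fs IH] fsP; first by rewrite big_nil.
rewrite big_cons mulr_ege1 //; last by apply: IH => g gfs; apply: fsP; right.
have [q2 _] := fsP f (or_introl erefl); rewrite exprn_ege1 //; lia.
Qed.

Lemma rows_sound (fs : system) k lim :
    (forall f, List.In f fs -> 2 <= f.1.1 /\ blocky f.2) ->
    row fs k <= lim -> lim < 4096 ->
  (row fs k, cells fs k.+1) \in rows (cells fs k) lim.
Proof.
elim: fs lim => [|f fs IH] lim fsP; first by rewrite /row big_nil.
have fsP' g : List.In g fs -> 2 <= g.1.1 /\ blocky g.2.
  by move=> gfs; apply: fsP; right.
have [q2 fB] := fsP f (or_introl erefl).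
have R1 := row_ge1 k fsP'; move: IH => /(_ _ fsP'); rewrite /row big_cons -/(row fs k) /=.
case: f q2 fB {fsP} => qm f /= q2 fB IH le lt.
have kpos : 1 <= qm.1 ^+ f k by rewrite exprn_ege1 //; lia.
set zero := map _ (rows (cells fs k) lim).
set pos := powers _ _ _ _ _ _ _.
have Hz : f k = 0%N -> (qm.1 ^+ f k * row fs k, (qm, hist f k.+1) :: cells fs k.+1) \in zero.
  move=> f0; apply/mapP; exists (row fs k, cells fs k.+1); last by rewrite /= f0 mul1r.
  by apply: IH => //; rewrite f0 mul1r in le.
have Hp : (0 < f k)%N -> (qm.1 ^+ f k * row fs k, (qm, hist f k.+1) :: cells fs k.+1) \in pos.
  move=> fpos; rewrite /pos -{2}[qm.1]expr1; apply: powers_sound => //.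
    rewrite fpos /= ltnNge; apply/negP => h.
    have : 2 ^+ 13 <= qm.1 ^+ f k.
      apply: (@le_trans _ _ (2 ^+ f k)); first by rewrite ler_weXn2l.
      by rewrite lerXn2r ?nnegrE //; lia.
    have -> : (2 : Z) ^+ 13 = 8192 by [].
    nia.
  move: kpos le; move: (qm.1 ^+ f k) => b b1 le; apply: IH.
    suff : Z.le (row fs k) (Z.div lim b) by lia.
    by apply: Z.div_le_lower_bound; lia.
  suff : Z.le (Z.div lim b) lim by lia.
  by apply: Z.div_le_upper_bound; nia.
have := forced_sound k fB; case: (forced _) => [[|m]|] fk; rewrite ?mem_cat.
- exact: Hp.
- exact: Hz.
- by case: (posnP (f k)) => [/Hz->//|/Hp->]; rewrite orbT.
Qed.

Definition congruences (f : modulus * (nat -> nat)) : Prop :=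
  [/\ forall i, f.2 i = 1%N ->
        exists y, T i ^+ 2 - E ^+ 2 = f.1.2 * (f.1.1 * f.1.1) * y,
      forall i, f.2 i = 2%N -> exists y, (T i.+1 * T i) ^+ 2 - E ^+ 4
        = f.1.2 * (f.1.1 * f.1.1 * (f.1.1 * f.1.1)) * y
    & forall i j, f.2 i = 0%N -> f.2 j = 0%N ->
        exists y, T i ^+ 2 - T j ^+ 2 = f.1.2 * y].

Lemma congruent_sound f k : congruences f ->
  congruent (E * E) (hist (fun i => T i * T i) k) (f.1, hist f.2 k).
Proof.
case: f => [[q m] f] [/= c1 c2 c0].
have D1 i : f i = 1%N -> divides (m * (q * q)) (T i * T i - E * E).
  by case/c1 => y yE; apply: (dividesI (y := y)); rewrite -[RHS]yE !expr2.
have D2 i : f i = 2%N ->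
    divides (m * (q * q * (q * q))) ((T i.+1 * T i.+1) * (T i * T i) - (E * E) * (E * E)).
  by case/c2 => y yE; apply: (dividesI (y := y)); rewrite -[RHS]yE; ring.
have D0 i j : f i = 0%N -> f j = 0%N -> divides m (T i * T i - T j * T j).
  by move=> fi /(c0 _ _ fi)[y yE]; apply: (dividesI (y := y)); rewrite -[RHS]yE !expr2.
case: k => [|k] //=; case fk: (f k) => [|[|r]] //=; last exact: D1.
case: k fk => [|k] //= fk; case fk1: (f k) => [|[|[|r]]] //=.
- exact: D0.
- by case: k fk {fk1} => [|k] //= fk; case fk2: (f k) => [|r] //=; exact: D0.
- exact: D2.
- by case: k fk {fk1} => [|k] //= fk; case fk2: (f k) => [|r'] //=; exact: D0.
Qed.

Definition recurrent : Prop := exists j d, [/\ (0 < d <= 3)%N,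
  T (j + d)%N ^+ 2 = T j ^+ 2 & (\prod_(l < d) T (j + l)%N) ^+ 2 = (E ^+ d) ^+ 2].

Lemma same_absP x y : same_abs x y -> x ^+ 2 = y ^+ 2.
Proof.
rewrite /same_abs => /Z.eqb_eq; rewrite !expr2 => h.
have : x = y \/ x = - y by lia.
by case=> ->; ring.
Qed.

Lemma recurs_sound k : recurs E (hist T k) -> recurrent.
Proof.
case: k => [//|[//|k]] /=.
case/orP => [/andP[/same_absP h1 /same_absP h2]|].
  by exists k, 1%N; rewrite addn1 big_ord1 addn0 expr1.
case: k => [//|k] /=; case/orP => [/andP[/same_absP h1 /same_absP h2]|].
  exists k, 2%N; rewrite !big_ord_recr big_ord0 /= addn2 addn1 addn0 mul1r; split=> //.
  by rewrite mulrC [LHS]h2.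
case: k => [//|k] /= /andP[/same_absP h1 /same_absP h2].
exists k, 3%N; rewrite !big_ord_recr big_ord0 /= addn3 addn2 addn1 addn0 mul1r; split=> //.
have -> : T k * T k.+1 * T k.+2 = T k.+2 * T k.+1 * T k by ring.
by rewrite [LHS]h2; congr (_ ^+ 2); rewrite !exprS expr0; ring.
Qed.

Lemma continue_sound fuel m (E12 lim N0 : Z) :
    let D0 := T 0%N ^+ 2 - E ^+ 2 in
    0 < E -> D0 != 0 -> (forall i, `|T i| <= lim) ->
    (forall i, exists y : Z, E12 = T i * y) ->
    (forall m, 2 * E * (T m.+2 - T 1%N) * (E ^+ (2 * m) * D0)
       = (T m.+1 ^+ 2 - T 0%N ^+ 2) * (E ^+ (2 * m) * D0)
         + N0 * ((\prod_(i < m.+1) T i) ^+ 2 - E ^+ (2 * m) * E * E)) ->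
  continue fuel E E12 lim (T 0%N) (T 1%N) N0 D0 (\prod_(i < m.+1) T i)
    (E ^+ (2 * m)) (T m.+1) (hist T m.+2) ->
  recurrent.
Proof.
move=> D0 E0 D0n Tlim TE rel; elim: fuel m => [//|fuel IH] m.
rewrite [continue _ _ _ _ _ _ _ _ _ _ _ _]/=.
case: ifP => [/(recurs_sound (k := m.+2))//|_].
set den := Z.mul _ D0; set num := Z.mul N0 _.
have den0 : den <> 0 by apply/eqP; rewrite mulf_neq0 // expf_neq0 // lt0r_neq0.
set z := 2 * E * (T m.+2 - T 1%N) - (T m.+1 ^+ 2 - T 0%N ^+ 2).
have numE : num = den * z.
  have aux (x y u v : Z) : x * u = y * u + v -> v = u * (x - y).
    by move=> h; rewrite mulrBr ![u * _]mulrC h addrC addKr.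
  by apply: aux; have := rel m; rewrite expr2.
rewrite (dividesI numE) /=.
have -> : Z.div num den = z.
  by rewrite numE -[GRing.mul _ _]/(Z.mul den z) Z.mul_comm Z.div_mul.
set y := Z.add _ z.
have yE : y = 2 * E * (T m.+2 - T 1%N).
  rewrite /y /z -[Z.add _ _]/((T m.+1 * T m.+1 - T 0%N * T 0%N) + z) /z; ring.
rewrite (dividesI yE) /=.
have -> : Z.add (Z.div y (Z.mul 2 E)) (T 1%N) = T m.+2.
  rewrite yE -[GRing.mul _ _]/(Z.mul (Z.mul 2 E) (T m.+2 - T 1%N)) Z.mul_comm Z.div_mul; lia.
have -> : Z.ltb lim (Z.abs (T m.+2)) = false by have := Tlim m.+2; lia.
have [w wE] := TE m.+2; rewrite (dividesI wE) /= => h; apply: (IH m.+1).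
rewrite big_ord_recr /=; have -> : E ^+ (2 * m.+1) = E ^+ (2 * m) * E * E.
  by rewrite mulnS exprD expr2; ring.
exact: h.
Qed.
End Sound.

Section Window.
Variables (E lim : Z) (T : nat -> Z) (fs : system).
Hypotheses (E_gt0 : 0 < E) (lim_lt : lim < 4096) (E_lt : E < 4096).
Hypothesis fsP : forall f, List.In f fs -> [/\ 2 <= f.1.1, blocky f.2 & congruences T E f].
Hypothesis T_row : forall i, `|T i| = row fs i.
Hypothesis T_lim : forall i, `|T i| <= lim.
Hypothesis T_dvd : forall i, exists y : Z, E ^+ 12 = T i * y.
Hypotheses (T0_gt : E < T 0%N) (T1_le : `|T 1%N| <= E).
Hypothesis T12_le : `|T 1%N * T 2%N| <= E ^+ 2.

Let N0 : Z := T 0%N ^+ 2 - T 1%N ^+ 2 - 2 * E * T 1%N + 2 * E * T 2%N.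
Let D0 : Z := T 0%N ^+ 2 - E ^+ 2.
Hypothesis N0_neq0 : N0 != 0.
Hypothesis T_rel : forall m,
  2 * E * (T m.+2 - T 1%N) * (E ^+ (2 * m) * D0)
  = (T m.+1 ^+ 2 - T 0%N ^+ 2) * (E ^+ (2 * m) * D0)
    + N0 * ((\prod_(i < m.+1) T i) ^+ 2 - E ^+ (2 * m) * E * E).

Let fsP2 f : List.In f fs -> 2 <= f.1.1 /\ blocky f.2.
Proof. by case/fsP. Qed.

Let row_pos i : 1 <= row fs i.
Proof. exact: row_ge1. Qed.

Let sqr_row i : Z.mul (row fs i) (row fs i) = T i * T i.
Proof.
by rewrite -[LHS]/(row fs i * row fs i) -T_row -normrM ger0_norm // -expr2 sqr_ge0.
Qed.

Let row0 : row fs 0 = T 0%N.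
Proof. by rewrite -T_row ger0_norm // (le_trans (ltW E_gt0) (ltW T0_gt)). Qed.

Let T_congruent k :
  all (congruent (E * E) (hist (fun i => T i * T i) k)) (cells fs k).
Proof.
elim: (fs) fsP => [//|f gs IH] gsP /=.
have [_ _ c] := gsP f (or_introl erefl); apply/andP; split.
  exact: congruent_sound.
by apply: IH => g ggs; apply: gsP; right.
Qed.

Lemma try_signs_sound : try_signs E lim (T 0%N) (T 1%N) (T 2%N) -> recurrent T E.
Proof.
rewrite /try_signs; set n0 := Z.add _ _.
have -> : n0 = N0 by rewrite /N0 !expr2.
have -> : Z.eqb N0 0 = false by have := N0_neq0; lia.
have -> : Z.pow E 12 = E ^+ 12 by rewrite !exprS expr0.
have -> : Z.mul (T 0%N) (T 1%N) = \prod_(i < 2) T i.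
  by rewrite !big_ord_recr big_ord0 /= mul1r.
apply: (@continue_sound T E 10 1 (E ^+ 12) lim N0 E_gt0 _ T_lim T_dvd T_rel).
have : 0 < (T 0%N - E) * (T 0%N + E) by apply: mulr_gt0; have := E_gt0; lia.
by rewrite -subr_sqr => /lt0r_neq0.
Qed.

Lemma try_third_sound : try_third E lim (T 0%N) (row fs 1) (row fs 2, cells fs 3) ->
  recurrent T E.
Proof.
rewrite /try_third [(_, _).1]/= [(_, _).2]/= !sqr_row.
rewrite (T_congruent 3) [~~ true]/=.
case: ifP => [rec _|_].
  have : recurs E (hist (fun i => `|T i|) 3) by rewrite /= !T_row row0.
  case/recurs_sound => j [d [d3 sq prod]]; exists j, d; split => //.
    by rewrite -[LHS]real_normK ?num_real // sq real_normK ?num_real.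
  by rewrite -[LHS]real_normK ?num_real // normr_prod prod.
have mem_sgn i : T i \in [:: row fs i; Z.opp (row fs i)].
  rewrite -T_row !inE; apply/orP; case: (ger0P (T i)) => h; [left|right] => //.
  by rewrite -[Z.opp _]/(- - T i) opprK.
move/allP/(_ _ (mem_sgn 1%N))/allP/(_ _ (mem_sgn 2)).
exact: try_signs_sound.
Qed.

Lemma try_second_sound : try_second E lim (T 0%N) (row fs 1, cells fs 2) ->
  recurrent T E.
Proof.
rewrite /try_second [(_, _).1]/= [(_, _).2]/= !sqr_row (T_congruent 2) [~~ true]/=.
set lim2 := Z.min _ _; suff r2 : (row fs 2, cells fs 3) \in rows (cells fs 2) lim2.
  by move/allP/(_ _ r2); exact: try_third_sound.
apply: rows_sound => //; rewrite /lim2; last by have := lim_lt; lia.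
have le2 := T_lim 2; rewrite T_row in le2.
suff : Z.le (row fs 2) (Z.div (Z.mul E E) (row fs 1)) by lia.
apply: Z.div_le_lower_bound; first by have := row_pos 1%N; lia.
by move: T12_le; rewrite normrM !T_row expr2; lia.
Qed.

Lemma try_first_sound : try_first E lim (T 0%N, cells fs 1) -> recurrent T E.
Proof.
rewrite /try_first [(_, _).1]/= [(_, _).2]/=.
have -> : Z.leb (T 0%N) E = false by have := T0_gt; lia.
rewrite (T_congruent 1) [~~ true]/=.
suff r1 : (row fs 1, cells fs 2) \in rows (cells fs 1) E.
  by move/allP/(_ _ r1); exact: try_second_sound.
by apply: rows_sound => //; rewrite -T_row.
Qed.

Lemma rows_first : (T 0%N, cells fs 1) \in rows (cells fs 0) lim.
Proof. by rewrite -row0; apply: rows_sound => //; rewrite -T_row. Qed.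
End Window.

(** The search starts from a positive T_0, whereas the sign of t_0 is free.
    Changing it affects neither the recurrence nor the conclusion, which only
    involve T_0^2 and squares of products. *)
Lemma search_sound (e : nat) (T : nat -> Z) (fs : system) :
    let E := Z.of_nat e in
    (0 < e <= 1000)%N -> (~~ odd e -> (e <= 500)%N) ->
    [seq f.1 | f <- fs] = [seq prime_modulus pk | pk <- prime_decomp e] ->
    (forall f, List.In f fs -> [/\ 2 <= f.1.1, blocky f.2 & congruences T E f]) ->
    (forall i, `|T i| = row fs i) -> (forall i, `|T i| <= bound e) ->
    (forall i, exists y : Z, E ^+ 12 = T i * y) ->
    E < `|T 0%N| -> `|T 1%N| <= E -> `|T 1%N * T 2%N| <= E ^+ 2 ->
    let N0 : Z := T 0%N ^+ 2 - T 1%N ^+ 2 - 2 * E * T 1%N + 2 * E * T 2%N in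
    N0 != 0 ->
    (forall m, let D0 : Z := T 0%N ^+ 2 - E ^+ 2 in
       2 * E * (T m.+2 - T 1%N) * (E ^+ (2 * m) * D0)
       = (T m.+1 ^+ 2 - T 0%N ^+ 2) * (E ^+ (2 * m) * D0)
         + N0 * ((\prod_(i < m.+1) T i) ^+ 2 - E ^+ (2 * m) * E * E)) ->
  search e -> recurrent T E.
Proof.
move=> E /andP[e0 e1000] e500 fsE fsP rowE Tle TE T0 T1 T12 N0 N0n rel.
pose T' i := if i is 0 then `|T 0%N| else T i.
have T'2 i : T' i ^+ 2 = T i ^+ 2 by case: i => //; rewrite /T' real_normK ?num_real.
have T'n i : `|T' i| = `|T i| by case: i => //; rewrite /T' normr_id.
have T'p (k j : nat) :
    (\prod_(i < k) T' (j + i)%N) ^+ 2 = (\prod_(i < k) T (j + i)%N) ^+ 2.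
  by rewrite -!prodrXl; apply: eq_bigr => i _.
rewrite /search; have -> : (~~ odd e && (500 < e)%N) = false.
  by case: (odd e) e500 => //= /(_ isT); rewrite ltnNge => ->.
have -> : [seq (prime_modulus pk, [::]) | pk <- prime_decomp e] = cells fs 0.
  rewrite /cells (eq_map (g := (fun qm => (qm, [::])) \o fst)) // map_comp fsE.
  by rewrite -map_comp.
have lt4096 := bound_lt4096 e1000.
have E_gt0 : 0 < E by rewrite /E; lia.
suff rec : all (try_first E (bound e)) (rows (cells fs 0) (bound e)) -> recurrent T' E.
  move=> /rec[j [d [d3 sq prod]]]; exists j, d; split => //; first by rewrite -!T'2.
  by rewrite -T'p.
have fsP' f : List.In f fs -> [/\ 2 <= f.1.1, blocky f.2 & congruences T' E f].
  move=> /fsP[q2 fB [c1 c2 c0]]; split=> //; split.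
  - by move=> i; rewrite T'2; exact: c1.
  - by move=> i; rewrite exprMn !T'2 -exprMn; exact: c2.
  - by move=> i j; rewrite !T'2; exact: c0.
have rowE' i : `|T' i| = row fs i by rewrite T'n.
have Tle' i : `|T' i| <= bound e by rewrite T'n.
have lim_lt : bound e < 4096 by lia.
have E_lt : E < 4096 by rewrite /E; lia.
have r0 : (T' 0%N, cells fs 1) \in rows (cells fs 0) (bound e).
  exact: (@rows_first E).
move/allP/(_ _ r0); apply: try_first_sound => //.
- case=> [|i]; last exact: TE.
  have [y yE] := TE 0%N; rewrite /T'; case: (ger0P (T 0%N)) => h; first by exists y.
  by exists (- y); rewrite mulrNN.
- by rewrite !T'2.
- move=> m; rewrite !T'2; have -> := T'p m.+1 0%N; exact: rel.
Qed.

(** * From rational orbits to integers *)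
Lemma logn_prod_primes (f : nat -> nat) (s : seq nat) (p : nat) :
    uniq s -> all prime s -> prime p ->
  logn p (\prod_(r <- s) r ^ f r) = (if p \in s then f p else 0)%N.
Proof.
move=> + + p_prime; elim: s => [|r s IH] /=; first by rewrite big_nil logn1.
case/andP=> rs us /andP[r_prime ps].
rewrite big_cons lognM; first last.
- rewrite big_seq prodn_cond_gt0 // => u us'; rewrite expn_gt0 prime_gt0 //.
  exact: (allP ps).
- by rewrite expn_gt0 prime_gt0.
rewrite IH // lognX logn_prime // inE.
by case: eqVneq => [->|_]; rewrite ?(negPf rs) ?muln1 ?addn0 ?muln0.
Qed.

Lemma logn_nonprime p m : ~~ prime p -> logn p m = 0%N.
Proof. by move=> /negPf np; rewrite lognE np. Qed.

Lemma padic2 p : prime p -> padic p 2 = (p%:R ^+ (p == 2%N))^-1.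
Proof.
by move=> p_prime; rewrite -[2]/(2%:~R) padic_int // logn_prime // eq_sym.
Qed.

Lemma denq1_padic (x : rat) : (forall p, prime p -> padic p x <= 1) -> denq x = 1.
Proof.
move=> xle; have [->|x0] := eqVneq x 0; first by [].
suff : `|denq x|%N = 1%N by have := denq_gt0 x; lia.
apply/eqP; rewrite -[_ == _]negbK; apply/negP => /eqP den1.
have den_gt1 : (1 < `|denq x|)%N by have := denq_gt0 x; lia.
have [p p_prime pd] := pdivP den_gt1.
have := xle p p_prime; rewrite leNgt => /negP; apply.
rewrite /padic (negPf x0) (@logn_coprime p `|numq x|%N) ?expr0 ?divr1.
  rewrite exprn_egt1 ?ltr1n ?prime_gt1 // -lt0n logn_gt0 mem_primes p_prime pd andbT.
  by lia.
apply: coprime_dvdl pd _; rewrite coprime_sym; exact: coprime_num_den.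
Qed.

Lemma dvdn_Z (x : int) (m : nat) :
  (m %| `|x|)%N -> exists y : Z, Z_of_int x = Z.of_nat m * y.
Proof.
rewrite -[m]/(absz m%:Z) -dvdzE => /dvdzP[y ->]; exists (Z_of_int y).
by rewrite rmorphM mulrC.
Qed.

Lemma prime_modulus_exp p k : prime_modulus (p, k)
  = (Z.of_nat (p ^ k), Z.of_nat (p ^ (k + (p == 2%N)))).
Proof.
rewrite /prime_modulus [(_, _).1]/= [(_, _).2]/=; congr (_, _).
case: eqP => [->|_]; last by rewrite addn0.
by rewrite addn1 expnS; move: (2 ^ k)%N => m; lia.
Qed.

Lemma of_nat_le_sqr (x y m : nat) : (x * y <= m * m)%N ->
  Z.of_nat x * Z.of_nat y <= Z.of_nat m ^+ 2.
Proof. by rewrite expr2; lia. Qed.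

Section Integers.
Variables (M : nat) (c : rat) (n : nat) (t d : nat -> rat).
Local Notation C := (4 * c).
Hypotheses (n_gt0 : (0 < n)%N) (d0_neq0 : d 0%N != 0).
Hypothesis tS : forall i, 2 * t i.+1 = t i ^+ 2 + d i + C.
Hypothesis dS : forall i, d i.+1 = t i ^+ 2 * d i.
Hypothesis t_per : forall i, t (i + n)%N = t i.
Hypothesis d_per : forall i, d (i + n)%N = d i.

Let t_neq0 : forall i, t i != 0.
Proof. exact: (t_neq0 n_gt0 d0_neq0 dS d_per). Qed.

Let B := `|denq C|%N.
(* p^(half p) is the q of p: |C|^(1/2) at the primes where |C| > 1 is a square,
   and 1 at all others. *)
Let half p := (if odd (logn p B) then 0 else (logn p B)./2)%N.
Let e := (\prod_(p <- primes B) p ^ half p)%N.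

Let B_gt0 : (0 < B)%N.
Proof. by rewrite absz_gt0 denq_eq0. Qed.

Let e_gt0 : (0 < e)%N.
Proof.
rewrite /e big_seq prodn_cond_gt0 // => p; rewrite mem_primes => /andP[p_prime _].
by rewrite expn_gt0 prime_gt0.
Qed.

Let logn_e p : logn p e = half p.
Proof.
have [p_prime|] := boolP (prime p); last first.
  by move=> np; rewrite /half !logn_nonprime.
rewrite /e logn_prod_primes ?primes_uniq //; last first.
  by apply/allP => r; rewrite mem_primes => /andP[].
case: ifP => // /negbT; rewrite -logn_gt0 -eqn0Ngt /half => /eqP -> //.
Qed.

Let e_sqr : (e ^ 2 %| B)%N.
Proof.
rewrite [X in (_ %| X)%N](prod_prime_decomp B_gt0) prime_decompE big_map /=.
have -> : (e ^ 2 = \prod_(p <- primes B) (p ^ half p) ^ 2)%N.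
  by rewrite /e (big_morph (expn^~ 2) (fun x y => expnMn x y 2) (exp1n 2)).
apply: (big_ind2 (fun x y => x %| y)%N) => // [x1 x2 y1 y2|p _].
  exact: dvdn_mul.
rewrite -expnM dvdn_exp2l // /half; case: ifP => // /negbT odd2.
by rewrite muln2 even_halfK.
Qed.

Let padic_C p : prime p -> (0 < logn p B)%N -> padic p C = p%:R ^+ logn p B.
Proof.
move=> p_prime; rewrite logn_gt0 mem_primes => /and3P[_ _ pB].
have C0 : C != 0 by apply: contraTneq pB; rewrite /B => ->; rewrite (_ : `|denq 0|%N = 1%N) // dvdn1 neq_ltn prime_gt1 ?orbT.
rewrite /padic (negPf C0) -/B (@logn_coprime p `|numq C|%N) ?expr0 ?divr1 //.
apply: coprime_dvdl pB _; rewrite coprime_sym; exact: coprime_num_den.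
Qed.

Let padic_C_le1 p : prime p -> logn p B = 0%N -> padic p C <= 1.
Proof.
move=> p_prime B0; rewrite /padic; case: eqP => // C0.
rewrite -/B B0 expr0 div1r invf_le1 ?exprn_gt0 ?ltr0n ?prime_gt0 //.
by rewrite exprn_ege1 // ler1n prime_gt0.
Qed.

(* At a prime where v_p(C) is odd, |t_i|^2 = |C| is impossible. *)
Let t_unit p : prime p -> half p = 0%N -> forall i, padic p (t i) = 1.
Proof.
move=> p_prime h0 i.
have [B0|Bpos] := posnP (logn p B).
  by apply: (padic_t_unit_integral n_gt0 d0_neq0 tS dS t_per d_per) => //; exact: padic_C_le1.
have CE := padic_C p_prime Bpos.
have C1 : 1 < padic p C by rewrite CE exprn_egt1 ?ltr1n ?prime_gt1 // -lt0n.
apply: (padic_t_unit_opp n_gt0 d0_neq0 tS dS t_per d_per) => // j.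
apply/eqP; rewrite -[_ == _]negbK; apply/negP.
move/(padic_t_same n_gt0 tS dS t_per d_per p_prime C1); rewrite CE.
have odd_B : odd (logn p B).
  move: h0; rewrite /half; case: ifP => // /negbT ev h0.
  by move: Bpos; rewrite -(even_halfK ev) h0.
rewrite /padic (negPf (t_neq0 j)).
set a := logn p _; set b := logn p `|numq _|%N => /eqP.
have p0 : p%:R != 0 :> rat by rewrite pnatr_eq0 -lt0n prime_gt0.
rewrite expr_div_n -[X in _ == X]divr1 eqr_div ?expf_neq0 ?oner_neq0 // mulr1.
rewrite -!exprM -exprD -!natrX eqr_nat => /eqP/(expnI (prime_gt1 p_prime)) h.
by move: (congr1 odd h); rewrite oddD !oddM !andbF odd_B.
Qed.

Let local p : prime p -> (0 < half p)%N -> exists exponent : nat -> nat,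
  let q : rat := p%:R ^+ half p in
  [/\ blocky exponent, forall i, padic p (t i) * q ^+ exponent i = q,
      forall i j, exponent i = 0%N -> exponent j = 0%N ->
        padic p (t i ^+ 2 - t j ^+ 2) <= padic p 2 * q
    & forall i r, exponent i = r.+1 ->
        padic p ((\prod_(j < r.+1) t (i + j)%N) ^+ 2 - 1) * q <= padic p 2].
Proof.
move=> p_prime hpos.
have Bpos : (0 < logn p B)%N by move: hpos; rewrite /half; case: ifP => // _; case: logn.
have evB : ~~ odd (logn p B) by move: hpos; rewrite /half; case: ifP.
have CE := padic_C p_prime Bpos.
have C1 : 1 < padic p C by rewrite CE exprn_egt1 ?ltr1n ?prime_gt1 // -lt0n.
set q : rat := p%:R ^+ half p.
have q_gt0 : 0 < q by rewrite exprn_gt0 // ltr0n prime_gt0.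
have CE2 : padic p C = q ^+ 2.
  by rewrite CE -exprM muln2 /half (negPf evB) even_halfK.
have q_ge : 1 <= padic p 2 * q.
  rewrite padic2 // mulrC ler_pdivlMr ?exprn_gt0 ?ltr0n ?prime_gt0 // mul1r.
  by rewrite ler_weXn2l ?ler1n ?prime_gt0 //; case: eqP.
exists (exponent n_gt0 d0_neq0 tS dS t_per d_per p_prime C1); split.
- exact: exponent_blocky.
- exact: padic_t_exponent.
- exact: padic_same_congr.
- exact: padic_block_congr.
Qed.

Let z i : int := numq (e%:R * t i).

Let padic_e p : prime p -> padic p e%:R = (p%:R ^+ half p)^-1.
Proof.
by move=> p_prime; rewrite -[e%:R]/(e%:~R) padic_int ?logn_e //; case: (e) e_gt0.
Qed.

Let padic_et p i : prime p -> padic p (e%:R * t i) = padic p (t i) / p%:R ^+ half p.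
Proof. by move=> p_prime; rewrite padicM // padic_e // mulrC. Qed.

Let zE i : (z i)%:~R = e%:R * t i.
Proof.
rewrite -[RHS]divq_num_den denq1_padic ?divr1 // => p p_prime; rewrite padic_et //.
have p_gt0 : 0 < p%:R ^+ half p :> rat by rewrite exprn_gt0 // ltr0n prime_gt0.
rewrite ler_pdivrMr // mul1r.
have [h0|hpos] := posnP (half p); first by rewrite t_unit // h0.
have [exponent [_ tq _ _]] := local p_prime hpos.
rewrite -[leRHS](tq i) ler_peMr ?padic_ge0 // exprn_ege1 // exprn_ege1 //.
by rewrite ler1n prime_gt0.
Qed.

Let z_neq0 i : z i != 0.
Proof.
by rewrite -(intr_eq0 rat) zE mulf_neq0 // pnatr_eq0 -lt0n.
Qed.

Let logn_z p i : prime p -> padic p (t i) * p%:R ^+ logn p `|z i|%N = p%:R ^+ half p.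
Proof.
move=> p_prime; have := padic_et i p_prime; rewrite -zE padic_int //.
have pX k : p%:R ^+ k != 0 :> rat by rewrite expf_neq0 // pnatr_eq0 -lt0n prime_gt0.
move=> h; have -> : padic p (t i) = p%:R ^+ half p / p%:R ^+ logn p `|z i|%N.
  by rewrite h mulrC divfK.
by rewrite divfK.
Qed.

Let expo p i : nat := (logn p `|z i| %/ half p)%N.

Let expo_local p : prime p -> (0 < half p)%N ->
  [/\ forall i, logn p `|z i|%N = (half p * expo p i)%N, blocky (expo p),
      forall i j, expo p i = 0%N -> expo p j = 0%N ->
        padic p (t i ^+ 2 - t j ^+ 2) <= padic p 2 * p%:R ^+ half p
    & forall i r, expo p i = r.+1 ->
        padic p ((\prod_(j < r.+1) t (i + j)%N) ^+ 2 - 1) * p%:R ^+ half p <= padic p 2].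
Proof.
move=> p_prime hpos; have [exponent [rB tq same block]] := local p_prime hpos.
have lE i : logn p `|z i|%N = (half p * exponent i)%N.
  have := tq i; rewrite -[in RHS](logn_z i p_prime) => /mulfI -/(_ _) h.
  have t0 : padic p (t i) != 0 by rewrite lt0r_neq0 // padic_gt0.
  have {h} := h t0; rewrite -exprM -!natrX => /eqP; rewrite eqr_nat => /eqP.
  by move/(expnI (prime_gt1 p_prime)).
have rE i : expo p i = exponent i by rewrite /expo lE mulKn.
split=> [i|i r|i j|i r]; rewrite !rE //; last exact: block; last exact: same.
move/rB => [zero next]; split=> // j /zero; by rewrite rE.
Qed.

Let T i : Z := Z_of_int (z i).
Let E : Z := Z.of_nat e.
Let fs : system := [seq (prime_modulus pk, expo pk.1) | pk <- prime_decomp e].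

Let half_gt0 p : (p \in primes e) = (0 < half p)%N.
Proof. by rewrite -logn_gt0 logn_e. Qed.

Let prime_e p : p \in primes e -> prime p.
Proof. by rewrite mem_primes => /andP[]. Qed.

Let fsE : fs = [seq (prime_modulus (p, half p), expo p) | p <- primes e].
Proof.
rewrite /fs prime_decompE -map_comp; apply: eq_map => p /=; by rewrite logn_e.
Qed.

Let absz_z i : `|z i|%N = (\prod_(p <- primes e) (p ^ half p) ^ expo p i)%N.
Proof.
have -> : (\prod_(p <- primes e) (p ^ half p) ^ expo p i
           = \prod_(p <- primes e) p ^ (half p * expo p i))%N.
  by apply: eq_bigr => p _; rewrite expnM.
apply: eqn_from_log => [||p]; first by rewrite absz_gt0.
  rewrite big_seq prodn_cond_gt0 // => p /prime_e p_prime.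
  by rewrite expn_gt0 prime_gt0.
have [p_prime|np] := boolP (prime p); last by rewrite !logn_nonprime.
rewrite logn_prod_primes ?primes_uniq //; last by apply/allP => r /prime_e.
rewrite half_gt0; have [h0|hpos] := posnP (half p); last by have [-> _ _ _] := expo_local p_prime hpos.
have := logn_z i p_prime; rewrite t_unit // mul1r h0 expr0 => /eqP.
rewrite -natrX -[1]/(1%:R) eqr_nat; case: logn => // k.
by rewrite expnS muln_eq1 => /andP[/eqP p1]; rewrite p1 in p_prime.
Qed.

Let T_absz i : `|T i| = Z.of_nat `|z i|%N.
Proof. by rewrite /T; lia. Qed.

Let T_row i : `|T i| = row fs i.
Proof.
rewrite T_absz /row fsE big_map absz_z (big_morph Z.of_nat (id1 := 1) (op1 := *%R)) //.
  by apply: eq_bigr => p _; rewrite prime_modulus_exp /= rmorphXn.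
exact: (rmorphM Z.of_nat).
Qed.

Hypothesis ME : Z.of_nat M = height_bound.
Hypothesis c_num : (`|numq c| <= M)%N.
Hypothesis c_den : (`|denq c| <= M)%N.

Let C_frac : exists h, `|denq c|%N = (B * h)%N /\ (`|numq C| * h = 4 * `|numq c|)%N.
Proof.
have e1 : (`|numq C| * `|denq c| = 4 * `|numq c| * B)%N.
  have : numq C * denq c = 4 * numq c * denq C.
    apply/eqP; rewrite -(eqr_int rat) !intrM; apply/eqP.
    have dC : (denq C)%:~R != 0 :> rat by rewrite intr_eq0 denq_eq0.
    have dc : (denq c)%:~R != 0 :> rat by rewrite intr_eq0 denq_eq0.
    by rewrite !numqE -[4%:~R]/(4 : rat); ring.
  by move/(congr1 absz); rewrite !abszM.
have cop : coprime B `|numq C| by rewrite coprime_sym; exact: coprime_num_den.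
have : (B %| `|numq C| * `|denq c|)%N by rewrite e1 dvdn_mull.
rewrite Gauss_dvdr // => /dvdnP[h hE]; exists h; split; first by rewrite hE mulnC.
by apply/eqP; rewrite -(eqn_pmul2r B_gt0) -e1 hE mulnA.
Qed.

(* Writing denq c = B h, the numerator of C times h is 4 times that of c.  If e is
   even, so is B, hence the numerator of C is odd and 4 divides h. *)
Let C_bounds : [/\ (`|numq C| <= if odd e then 4 * M else M)%N,
  (e <= 1000)%N & ~~ odd e -> (e <= 500)%N].
Proof.
have [h [bE aE]] := C_frac.
have h0 : (0 < h)%N.
  by rewrite lt0n; apply/eqP => h0; move: (denq_neq0 c); rewrite -absz_eq0 bE h0 muln0.
have e2 : (e * e <= B)%N by have := dvdn_leq B_gt0 e_sqr; rewrite mulnn.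
have Bh : (B * h <= M)%N by rewrite -bE.
have M_val := ME; rewrite /height_bound in M_val.
case: (boolP (odd e)) => [_|ev_e].
  have aM : (`|numq C| <= 4 * M)%N.
    apply: (@leq_trans (`|numq C| * h)); first by rewrite leq_pmulr.
    by rewrite aE leq_mul2l c_num orbT.
  split=> //; nia.
have /dvdnP[h' hE] : (4 %| h)%N.
  have cop4 : coprime 4 `|numq C|.
    rewrite (coprimeXl 2 (m := 2)) //.
    apply: (@coprime_dvdl _ B); last by rewrite coprime_sym; exact: coprime_num_den.
    by apply: dvdn_trans e_sqr; rewrite expnS dvdn_mulr // dvdn2.
  by rewrite -(Gauss_dvdr h cop4) aE dvdn_mulr.
have h'0 : (0 < h')%N by move: h0; rewrite hE; case: (h').
have aM : (`|numq C| <= M)%N.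
  apply: leq_trans c_num.
  have : (`|numq C| <= `|numq C| * h')%N by rewrite leq_pmulr.
  by move: aE; rewrite hE; lia.
by split=> [//||_]; nia.
Qed.

Let abs_z i : (`|z i|%N)%:R = e%:R * `|t i| :> rat.
Proof. by rewrite natr_absz intr_norm zE normrM ger0_norm // ler0n. Qed.

Let C_norm : `|C| * (e * e)%:R <= (`|numq C|%N)%:R.
Proof.
rewrite -{1}(divq_num_den C) normrM normfV -!intr_norm.
have -> : `|denq C| = B%:Z by rewrite /B; lia.
have -> : `|numq C| = `|numq C|%N%:Z by lia.
rewrite mulrAC ler_pdivrMr ?ltr0n // ler_wpM2l ?ler0n // ler_nat mulnn.
exact: dvdn_leq.
Qed.

Let T_lim i : `|T i| <= bound e.
Proof.
have [aM e1000 _] := C_bounds.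
rewrite T_absz; set X := `|z i|%N; rewrite /bound; set s := Z.add (if _ then _ else _) _.
have s0 := Z.sqrt_nonneg s.
have [Xe|eX] := leqP X e; first by lia.
suff : ((X - e) * (X - e) <= (if odd e then 4 * M else M) + 2 * (e * e))%N.
  move=> h; suff : Z.le (Z.of_nat X - Z.of_nat e) (Z.sqrt s) by lia.
  apply/Z.sqrt_le_square; [|lia|].
    by rewrite /s; case: (odd e); lia.
  by move: h; rewrite /s -?ME; case: (odd e); lia.
apply: (@leq_trans (`|numq C| + 2 * (e * e))); last by rewrite leq_add2r.
rewrite -(ler_nat rat) natrM natrB 1?ltnW // abs_z natrD.
have := C_norm; have := t_archimedean n_gt0 tS dS t_per d_per i.
rewrite !natrM; move: (e%:R : rat) (ler0n rat e) => E' E0 h1 h2.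
apply: le_trans (_ : `|C| * (E' * E') + 2 * (E' * E') <= _); last first.
  by rewrite lerD2r.
have -> : (E' * `|t i| - E') * (E' * `|t i| - E') = (E' * E') * (`|t i| - 1) ^+ 2 by ring.
by rewrite -mulrDl mulrC ler_wpM2r // mulr_ge0.
Qed.

Let expo_le p i : p \in primes e -> (expo p i <= 12)%N.
Proof.
move=> pe; have p_prime := prime_e pe; have hpos : (0 < half p)%N by rewrite -half_gt0.
have [lE _ _ _] := expo_local p_prime hpos.
have [_ e1000 _] := C_bounds.
have X4096 : (`|z i| < 2 ^ 12)%N.
  have := bound_lt4096 e1000; have := T_lim i; rewrite /T.
  have -> : (2 ^ 12 = 4096)%N by []; lia.
rewrite leqNgt; apply/negP => h.
have : (2 ^ 12 <= `|z i|)%N.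
  apply: leq_trans (_ : p ^ logn p `|z i| <= _)%N; last first.
    by rewrite dvdn_leq ?pfactor_dvdnn // absz_gt0.
  apply: leq_trans (_ : p ^ 12 <= _)%N; first by rewrite leq_exp2r // prime_gt1.
  rewrite leq_exp2l ?prime_gt1 // lE; apply: leq_trans (ltnW h) _; exact: leq_pmull.
by rewrite leqNgt X4096.
Qed.

Let T_dvd i : exists y : Z, E ^+ 12 = T i * y.
Proof.
have : (`|z i| %| e ^ 12)%N.
  rewrite absz_z [X in (_ %| X ^ _)%N](prod_prime_decomp e_gt0) prime_decompE big_map /=.
  rewrite (big_morph (expn^~ 12) (fun x y => expnMn x y 12) (exp1n 12)).
  rewrite big_seq [X in (_ %| X)%N]big_seq.
  apply: (big_ind2 (fun x y => x %| y)%N) => // [x1 x2 y1 y2|p pe]; first exact: dvdn_mul.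
  by rewrite logn_e dvdn_exp2l // expo_le.
rewrite -[X in (_ %| X)%N]/(absz (e ^ 12)%N%:Z) -dvdzE => /dvdzP[y yE].
exists (Z_of_int y); rewrite mulrC -rmorphM -yE /E.
by rewrite -rmorphXn.
Qed.

Let congr_Z p j (x : int) : prime p ->
    padic p x%:~R * (p%:R ^+ half p) ^+ j * p%:R ^+ half p <= padic p 2 ->
  exists y : Z, Z_of_int x
    = (prime_modulus (p, half p)).2 * (prime_modulus (p, half p)).1 ^+ j * y.
Proof.
move=> p_prime; rewrite padic2 //.
have pX k : 0 < p%:R ^+ k :> rat by rewrite exprn_gt0 // ltr0n prime_gt0.
rewrite -mulrA -!exprM -!exprD -ler_pdivlMr // -invfM -exprD padic_int_le // => /dvdn_Z[y ->].
exists y; rewrite prime_modulus_exp /= -rmorphXn -rmorphM natrXE natrME -expnM -expnD.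
congr (Z.of_nat (_ ^ _) * _); lia.
Qed.

Let ZB (x y : int) : Z_of_int (x - y) = Z_of_int x - Z_of_int y.
Proof. exact: rmorphB. Qed.
Let ZM (x y : int) : Z_of_int (x * y) = Z_of_int x * Z_of_int y.
Proof. exact: rmorphM. Qed.
Let ZX (x : int) k : Z_of_int (x ^+ k) = Z_of_int x ^+ k.
Proof. exact: rmorphXn. Qed.
Let ZN (x : int) : Z_of_int (- x) = - Z_of_int x.
Proof. exact: rmorphN. Qed.
Let ZD (x y : int) : Z_of_int (x + y) = Z_of_int x + Z_of_int y.
Proof. exact: rmorphD. Qed.
Let Z2 : Z_of_int 2 = 2. Proof. by []. Qed.
Let EE : E = Z_of_int e%:Z. Proof. by []. Qed.

Let padic_eX p k : prime p -> padic p (e%:R ^+ k) * (p%:R ^+ half p) ^+ k = 1.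
Proof.
move=> p_prime; rewrite padicX // padic_e // -exprMn mulVf ?expr1n //.
by rewrite expf_neq0 // pnatr_eq0 -lt0n prime_gt0.
Qed.

Let block_Z p i r : prime p -> (0 < half p)%N -> expo p i = r.+1 ->
  exists y : Z, (\prod_(j < r.+1) T (i + j)%N) ^+ 2 - (E ^+ r.+1) ^+ 2
    = (prime_modulus (p, half p)).2
      * (prime_modulus (p, half p)).1 ^+ (r.+1 * 2) * y.
Proof.
move=> p_prime hpos ei; have [_ _ _ /(_ _ _ ei) block] := expo_local p_prime hpos.
have -> : (\prod_(j < r.+1) T (i + j)%N) ^+ 2 - (E ^+ r.+1) ^+ 2
    = Z_of_int ((\prod_(j < r.+1) z (i + j)%N) ^+ 2 - (e%:Z ^+ r.+1) ^+ 2).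
  rewrite ZB !ZX -EE; congr (_ ^+ 2 - _).
  by rewrite (big_morph Z_of_int ZM (erefl : Z_of_int 1 = 1)).
apply: congr_Z => //.
have -> : ((\prod_(j < r.+1) z (i + j)%N) ^+ 2 - (e%:Z ^+ r.+1) ^+ 2)%:~R
    = e%:R ^+ (r.+1 * 2) * ((\prod_(j < r.+1) t (i + j)%N) ^+ 2 - 1) :> rat.
  rewrite intrB !rmorphXn /= rmorph_prod /=.
  under eq_bigr do rewrite zE.
  by rewrite big_split /= prodr_const card_ord exprM exprMn mulrBr mulr1.
by rewrite padicM // [X in X * _]mulrAC padic_eX // mul1r.
Qed.

Let same_Z p i j : prime p -> (0 < half p)%N -> expo p i = 0%N -> expo p j = 0%N ->
  exists y : Z, T i ^+ 2 - T j ^+ 2 = (prime_modulus (p, half p)).2 * y.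
Proof.
move=> p_prime hpos ei ej; have [_ _ /(_ _ _ ei ej) same _] := expo_local p_prime hpos.
have -> : T i ^+ 2 - T j ^+ 2 = Z_of_int (z i ^+ 2 - z j ^+ 2) by rewrite ZB !ZX.
have := @congr_Z p 0 (z i ^+ 2 - z j ^+ 2) p_prime; rewrite !expr0 !mulr1; apply.
have -> : (z i ^+ 2 - z j ^+ 2)%:~R = e%:R ^+ 2 * (t i ^+ 2 - t j ^+ 2) :> rat.
  by rewrite intrB !rmorphXn /= !zE !exprMn mulrBr.
have q_gt0 : 0 < p%:R ^+ half p :> rat by rewrite exprn_gt0 // ltr0n prime_gt0.
rewrite padicM // -(ler_pM2r q_gt0) -[leLHS]mulrA -expr2 mulrAC padic_eX //.
by rewrite mul1r.
Qed.

Let fsP f : List.In f fs -> [/\ 2 <= f.1.1, blocky f.2 & congruences T E f].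
Proof.
have In_mem (s : seq nat) (x : nat) : List.In x s -> x \in s.
  by elim: s => [|y s IH] //= [->|/IH]; rewrite inE ?eqxx // => ->; rewrite orbT.
rewrite fsE => /List.in_map_iff[p [<- /In_mem pe]].
have p_prime := prime_e pe; have hpos : (0 < half p)%N by rewrite -half_gt0.
have [_ eB _ _] := expo_local p_prime hpos.
split=> //.
  rewrite prime_modulus_exp /=; have : (p ^ 1 <= p ^ half p)%N.
    by rewrite leq_exp2l // prime_gt1.
  by have := prime_gt1 p_prime; rewrite expn1; lia.
split=> [i /(block_Z p_prime hpos)[y]|i /(block_Z p_prime hpos)[y]|i j] /=.
- by rewrite big_ord1 addn0 expr1 expr2 => ->; exists y.
- rewrite !big_ord_recr big_ord0 /= mul1r addn0 addn1 -exprM mulrC => h; exists y.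
  have q4 (q : Z) : q * q * (q * q) = q ^+ 4 by ring.
  by rewrite q4; move: h; rewrite (_ : (2 * 2)%N = 4%N).
- exact: same_Z.
Qed.

Let N0_d : t 0%N ^+ 2 - t 1%N ^+ 2 - 2 * t 1%N + 2 * t 2%N
  = d 0%N * (t 0%N ^+ 2 - 1).
Proof. by rewrite !tS dS; ring. Qed.

Let RX (x : int) k : (x ^+ k)%:~R = x%:~R ^+ k :> rat.
Proof. exact: rmorphXn. Qed.
Let R2 : (2 : int)%:~R = 2 :> rat. Proof. by []. Qed.
Let RN (x : int) : (- x)%:~R = - x%:~R :> rat.
Proof. exact: rmorphN. Qed.

Let z_rel m :
  2 * e%:Z * (z m.+2 - z 1%N) * (e%:Z ^+ (2 * m) * (z 0%N ^+ 2 - e%:Z ^+ 2))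
  = (z m.+1 ^+ 2 - z 0%N ^+ 2) * (e%:Z ^+ (2 * m) * (z 0%N ^+ 2 - e%:Z ^+ 2))
    + (z 0%N ^+ 2 - z 1%N ^+ 2 - 2 * e%:Z * z 1%N + 2 * e%:Z * z 2%N)
      * ((\prod_(i < m.+1) z i) ^+ 2 - e%:Z ^+ (2 * m) * e%:Z * e%:Z).
Proof.
set P := \prod_(i < m.+1) t i.
have zP : (\prod_(i < m.+1) z i)%:~R = e%:R ^+ m.+1 * P.
  rewrite (big_morph _ (@intrM rat) (erefl : (1%:~R : rat) = 1)).
  by under eq_bigr do rewrite zE; rewrite big_split /= prodr_const card_ord.
have dP : d m.+1 = P ^+ 2 * d 0%N by have := d_prod dS 0%N m.+1.
have N0E : (e%:R * t 0%N) ^+ 2 - (e%:R * t 1%N) ^+ 2 - 2 * e%:R * (e%:R * t 1%N)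
    + 2 * e%:R * (e%:R * t 2%N) = e%:R ^+ 2 * (d 0%N * (t 0%N ^+ 2 - 1)) :> rat.
  by rewrite -N0_d; ring.
have h1 : 2 * t m.+2 = t m.+1 ^+ 2 + P ^+ 2 * d 0%N + C by rewrite tS dP.
have h0 : 2 * t 1%N = t 0%N ^+ 2 + d 0%N + C by rewrite tS.
apply: (@intr_inj rat).
rewrite !(R2, RN, intrD, intrM, RX) zP !zE.
have -> : (e%:Z)%:~R = e%:R :> rat by [].
rewrite N0E.
have -> : 2 * e%:R * (e%:R * t m.+2 - e%:R * t 1%N)
   = e%:R ^+ 2 * (2 * t m.+2 - 2 * t 1%N) :> rat by ring.
rewrite h1 h0 (exprS _ m) [(2 * m)%N]mulnC exprM.
by move: (e%:R ^+ m) => w; ring.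
Qed.

Let T_rel m (D0 := T 0%N ^+ 2 - E ^+ 2 : Z) :
  2 * E * (T m.+2 - T 1%N) * (E ^+ (2 * m) * D0)
  = (T m.+1 ^+ 2 - T 0%N ^+ 2) * (E ^+ (2 * m) * D0)
    + (T 0%N ^+ 2 - T 1%N ^+ 2 - 2 * E * T 1%N + 2 * E * T 2%N)
      * ((\prod_(i < m.+1) T i) ^+ 2 - E ^+ (2 * m) * E * E).
Proof.
have Zp : Z_of_int (\prod_(i < m.+1) z i) = \prod_(i < m.+1) T i.
  by rewrite (big_morph Z_of_int ZM (erefl : Z_of_int 1 = 1)).
have := congr1 Z_of_int (z_rel m).
by rewrite !(Z2, ZN, ZD, ZM, ZX, Zp) -EE.
Qed.

Let Z_of_int0 x : (Z_of_int x == 0) = (x == 0).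
Proof. by apply/idP/idP => /eqP h; apply/eqP; lia. Qed.

(** The orbit, read from an index with |t_0| > 1 >= |t_1| and |t_1 t_2| <= 1, is
    covered by the search. *)
Lemma window_recurrent :
    1 < `|t 0%N| -> `|t 1%N| <= 1 -> `|t 1%N * t 2%N| <= 1 ->
  exists j k, [/\ (0 < k <= 3)%N, t (j + k)%N ^+ 2 = t j ^+ 2
    & (\prod_(l < k) t (j + l)%N) ^+ 2 = 1].
Proof.
move=> t0 t1 t12.
have [_ e1000 e500] := C_bounds.
have eR : 0 < e%:R :> rat by rewrite ltr0n.
have rec : recurrent T E.
  apply: (@search_sound e T fs) => //.
  - by rewrite e_gt0.
  - by rewrite /fs -map_comp.
  - suff : (e < `|z 0%N|)%N by rewrite /T; lia.
    by rewrite -(ltr_nat rat) abs_z ltr_pMr.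
  - suff : (`|z 1%N| <= e)%N by rewrite /T; lia.
    by rewrite -(ler_nat rat) abs_z ger_pMr.
  - have : (`|z 1%N| * `|z 2%N| <= e * e)%N.
      rewrite -(ler_nat rat) !natrM !abs_z mulrACA -normrM.
      by rewrite ger_pMr // mulr_gt0.
    by rewrite normrM !T_absz; exact: of_nat_le_sqr.
  - have -> : T 0%N ^+ 2 - T 1%N ^+ 2 - 2 * E * T 1%N + 2 * E * T 2%N
      = Z_of_int (z 0%N ^+ 2 - z 1%N ^+ 2 - 2 * e%:Z * z 1%N + 2 * e%:Z * z 2%N).
            by rewrite !(Z2, ZN, ZD, ZM, ZX) -EE.
    rewrite Z_of_int0 -(intr_eq0 rat).
    rewrite !(R2, RN, intrD, intrM, RX) !zE.
    have -> : (e%:Z)%:~R = e%:R :> rat by [].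
    have -> : (e%:R * t 0%N) ^+ 2 - (e%:R * t 1%N) ^+ 2 - 2 * e%:R * (e%:R * t 1%N)
      + 2 * e%:R * (e%:R * t 2%N)
      = e%:R ^+ 2 * (t 0%N ^+ 2 - t 1%N ^+ 2 - 2 * t 1%N + 2 * t 2%N) :> rat by ring.
    rewrite N0_d; apply: mulf_neq0; first by rewrite expf_neq0 // lt0r_neq0.
    apply: mulf_neq0 => //; apply: lt0r_neq0.
    by rewrite -(real_normK (num_real (t 0%N))) subr_gt0 exprn_egt1.
  - exact: (search_holds (introT andP (conj e_gt0 e1000))).
have [j [k [k3 sq prod]]] := rec; exists j, k; split=> //.
  have : z (j + k)%N ^+ 2 = z j ^+ 2.
    by apply: (can_inj Z_of_intK); rewrite !ZX.
  move/(congr1 (intr : int -> rat)); rewrite !rmorphXn /= !zE !exprMn.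
  by apply: mulfI; rewrite expf_neq0 // lt0r_neq0.
have : (\prod_(l < k) z (j + l)%N) ^+ 2 = (e%:Z ^+ k) ^+ 2.
  apply: (can_inj Z_of_intK); rewrite !ZX -EE -prod.
  by rewrite (big_morph Z_of_int ZM (erefl : Z_of_int 1 = 1)).
move/(congr1 (intr : int -> rat)); rewrite !rmorphXn /=.
rewrite (big_morph _ (@intrM rat) (erefl : (1%:~R : rat) = 1)).
under eq_bigr do rewrite zE.
rewrite big_split /= prodr_const card_ord exprMn -[RHS]mulr1.
by apply: mulfI; rewrite !expf_neq0 // lt0r_neq0.
Qed.
End Integers.

(** * The trace-discriminant sequence recurs within three steps *)
Section Recurrence.
Variables (M : nat) (c : rat) (n : nat) (t d : nat -> rat).
Hypothesis ME : Z.of_nat M = height_bound.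
Hypothesis c_num : (`|numq c| <= M)%N.
Hypothesis c_den : (`|denq c| <= M)%N.
Hypotheses (n_gt0 : (0 < n)%N) (d0_neq0 : d 0%N != 0).
Hypothesis tS : forall i, 2 * t i.+1 = t i ^+ 2 + d i + 4 * c.
Hypothesis dS : forall i, d i.+1 = t i ^+ 2 * d i.
Hypothesis t_per : forall i, t (i + n)%N = t i.
Hypothesis d_per : forall i, d (i + n)%N = d i.

Let d_neq0 : forall i, d i != 0.
Proof. exact: (d_neq0 n_gt0 d0_neq0 dS d_per). Qed.

(** A window as required by [window_recurrent] sits where |d| jumps to its
    maximum.  If |d| never jumps it is constant, and then t_i^2 = 1 throughout. *)
Lemma orbit_recurrent : exists j k, [/\ (0 < k <= 3)%N,
  t (j + k)%N ^+ 2 = t j ^+ 2 & d (j + k)%N = d j].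
Proof.
suff : exists j k, [/\ (0 < k <= 3)%N, t (j + k)%N ^+ 2 = t j ^+ 2
    & (\prod_(l < k) t (j + l)%N) ^+ 2 = 1].
  move=> [j [k [k3 sq prod]]]; exists j, k; split=> //.
  by rewrite (d_prod dS) prod mul1r.
have d_mod j : d (j %% n)%N = d j.
  rewrite [in RHS](divn_eq j n) addnC; elim: (j %/ n)%N => [|u IH].
    by rewrite addn0.
  by rewrite mulSn addnCA addnC d_per.
have [i0 i0max] : exists i0, forall j, `|d j| <= `|d i0|.
  pose i0 := [arg max_(i > Ordinal n_gt0) `|d i|]%O.
  exists i0 => j; rewrite /i0; case: arg_maxP => // i _ imax.
  rewrite -d_mod; have jn : (j %% n < n)%N by rewrite ltn_mod.
  exact: (imax (Ordinal jn)).
have tsq i : t i ^+ 2 = `|d i.+1| / `|d i|.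
  by rewrite dS normrM (ger0_norm (sqr_ge0 _)) mulfK // normr_eq0.
have [/forallP all_max|] := boolP [forall j : 'I_n, `|d j| == `|d i0|].
  have dmax j : `|d j| = `|d i0|.
    rewrite -d_mod; have jn : (j %% n < n)%N by rewrite ltn_mod.
    exact/eqP/(all_max (Ordinal jn)).
  have t1 i : t i ^+ 2 = 1 by rewrite tsq !dmax divff // normr_eq0.
  by exists 0%N, 1%N; rewrite !t1 big_ord1 t1.
case/forallPn => [[j0 /= _] j0lt].
have reach : exists r, `|d (j0 + r)%N| == `|d i0|.
  exists (i0 + j0 * n - j0)%N.
  have le : (j0 <= i0 + j0 * n)%N by rewrite (leq_trans (leq_pmulr j0 n_gt0)) ?leq_addl.
  by rewrite subnKC // -(d_mod (i0 + j0 * n)%N) addnC modnMDl d_mod.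
case: (ex_minnP reach) => [[|r]] /eqP rE rmin; first by rewrite addn0 in rE; rewrite rE eqxx in j0lt.
pose w := (j0 + r)%N; rewrite addnS -/w in rE.
have w_lt : `|d w| < `|d w.+1|.
  by rewrite rE lt_neqAle i0max andbT; apply/negP => /rmin; rewrite ltnn.
have d_gt0 i : 0 < `|d i| by rewrite normr_gt0.
have sqr_norm_le1 (x : rat) : x ^+ 2 <= 1 -> `|x| <= 1.
  by rewrite -(real_normK (num_real x)) expr_le1.
have [|||||||||||j [k [k3 sq prod]]] := @window_recurrent M c n
    (fun i => t (i + w)%N) (fun i => d (i + w)%N) n_gt0.
- exact: d_neq0.
- by move=> i; exact: tS.
- by move=> i; exact: dS.
- by move=> i; rewrite addnAC t_per.
- by move=> i; rewrite addnAC d_per.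
- exact: ME.
- exact: c_num.
- exact: c_den.
- rewrite add0n -(expr_gt1 (n := 2)) // real_normK ?num_real // tsq.
  by rewrite ltr_pdivlMr ?mul1r.
- by apply: sqr_norm_le1; rewrite add1n tsq ler_pdivrMr ?mul1r // rE.
- apply: sqr_norm_le1; rewrite exprMn add1n add2n !tsq mulrC mulf_div.
  by rewrite [X in X / _]mulrC -mulf_div divff ?mul1r ?lt0r_neq0 // ler_pdivrMr // mul1r rE.
exists (j + w)%N, k; rewrite k3 [(j + w + k)%N]addnAC sq; split=> //.
by rewrite -[RHS]prod; congr (_ ^+ 2); apply: eq_bigr => l _; rewrite addnAC.
Qed.
End Recurrence.

(** * Periodic points in a quadratic field *)
Lemma quadratic_relation (K : fieldExtType rat) (alpha : K) :
    quadratic_field K -> alpha \notin 1%VS ->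
  exists u v : rat, alpha ^+ 2 = u%:A * alpha + v%:A.
Proof.
move=> K2 alphaN; pose U := (1 + <[alpha]>)%VS : {vspace K}.
have sub1U : (1 <= U)%VS := addvSl _ _.
have : (\dim (1%VS : {vspace K}) < \dim U)%N.
  rewrite ltn_neqAle dimvS // andbT; apply: contra alphaN => /eqP eqd.
  have /eqP -> : (1%VS == U) by rewrite eqEdim sub1U eqd leqnn.
  by rewrite (subvP (addvSr _ _)) ?memv_line.
rewrite dimv1 => dimU.
have UE : U = fullv.
  by apply/eqP; rewrite eqEdim subvf K2.
have : alpha ^+ 2 \in U by rewrite UE memvf.
case/memv_addP=> x /vlineP[v ->] [y /vlineP[u ->] ->].
by exists u, v; rewrite addrC mulr_algl.
Qed.

Section Pairs.
Variables (K : fieldExtType rat) (c t0 d0 : rat) (alpha beta : K).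
Hypothesis sum_rat : alpha + beta = t0%:A.
Hypothesis diff_rat : (alpha - beta) ^+ 2 = d0%:A.
Local Notation f := (fun x : K => x ^+ 2 + c%:A).

Definition trace_step (s : rat * rat) : rat * rat :=
  ((s.1 ^+ 2 + s.2 + 4 * c) / 2, s.1 ^+ 2 * s.2).
Local Notation s i := (iter i trace_step (t0, d0)).

Lemma alg_inj (x y : rat) : x%:A = y%:A :> K -> x = y.
Proof. exact: (fmorph_inj (in_alg K)). Qed.

Lemma iter_pair i :
  iter i f alpha + iter i f beta = (s i).1%:A /\
  (iter i f alpha - iter i f beta) ^+ 2 = (s i).2%:A.
Proof.
elim: i => [|i [IHs IHd]]; first by [].
rewrite !iterS; move: (iter i f alpha) (iter i f beta) (s i) IHs IHd => a b [t d] /= hs hd.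
have hA (x : rat) : x%:A = in_alg K x by [].
split.
  have -> : a ^+ 2 + c%:A + (b ^+ 2 + c%:A)
      = ((a + b) ^+ 2 + (a - b) ^+ 2 + 4 * c%:A) / 2.
    by field; rewrite (_ : (2 : K) = in_alg K 2) ?fmorph_eq0 // rmorph_nat.
  rewrite hs hd !hA -[4 : K](rmorph_nat (in_alg K) 4) -[2 : K](rmorph_nat (in_alg K) 2).
  by rewrite -rmorphM -rmorphXn -!rmorphD -fmorph_div.
have -> : a ^+ 2 + c%:A - (b ^+ 2 + c%:A) = (a + b) * (a - b) by ring.
by rewrite exprMn hs hd !hA rmorphM rmorphXn.
Qed.

Lemma iter_diff i :
  iter i f alpha - iter i f beta = (\prod_(j < i) (s j).1)%:A * (alpha - beta).
Proof.
elim: i => [|i IH]; first by rewrite big_ord0 scale1r mul1r.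
have [hs _] := iter_pair i.
rewrite !iterS big_ord_recr /=.
have -> : iter i f alpha ^+ 2 + c%:A - (iter i f beta ^+ 2 + c%:A)
  = (iter i f alpha + iter i f beta) * (iter i f alpha - iter i f beta) by ring.
rewrite hs IH -[_%:A * _ in RHS]/(in_alg K _ * _) rmorphM /=.
by rewrite mulrA [X in X * _]mulrC.
Qed.

Lemma iter_return i : s i = (t0, d0) -> \prod_(l < i) (s l).1 = 1 ->
  iter i f alpha = alpha.
Proof.
move=> si p1; have [hs _] := iter_pair i; have hd := iter_diff i.
rewrite p1 scale1r mul1r in hd; rewrite si -sum_rat in hs.
have : 2 * iter i f alpha = 2 * alpha.
  have -> : 2 * iter i f alpha = (iter i f alpha + iter i f beta)
    + (iter i f alpha - iter i f beta) by ring.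
  by rewrite hs hd; ring.
by apply: mulfI; rewrite -(rmorph_nat (in_alg K) 2) fmorph_eq0.
Qed.

(** If (t, d) has period k then alpha - beta is multiplied over k steps by a
    rational whose square is 1, hence by 1 over 2 k steps. *)
Lemma short_period (M n : nat) :
    Z.of_nat M = height_bound -> (`|numq c| <= M)%N -> (`|denq c| <= M)%N ->
    (0 < n)%N -> d0 != 0 -> s n = (t0, d0) ->
  exists2 m, (0 < m <= 6)%N & iter m f alpha = alpha.
Proof.
move=> ME c_num c_den n0 d0n sn.
have s_per i : s (i + n)%N = s i by rewrite iterD sn.
pose t i := (s i).1; pose d i := (s i).2.
have tS i : 2 * t i.+1 = t i ^+ 2 + d i + 4 * c by rewrite /t /d iterS /=; field.
have dS i : d i.+1 = t i ^+ 2 * d i by rewrite /t /d iterS.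
have t_per i : t (i + n)%N = t i by rewrite /t s_per.
have d_per i : d (i + n)%N = d i by rewrite /d s_per.
have [j [k [k3 tjk djk]]] := orbit_recurrent ME c_num c_den n0 d0n tS dS t_per d_per.
have sjk : s (j.+1 + k)%N = s j.+1.
  by rewrite addSn !iterS /trace_step -!/(t _) -!/(d _) tjk djk.
have s_mul u : s (u * n)%N = (t0, d0).
  by elim: u => [|u IH] //; rewrite mulSn addnC s_per.
have sk : s k = (t0, d0).
  have le : (j.+1 <= j.+1 * n)%N by rewrite leq_pmulr.
  have := s_mul j.+1; rewrite -(subnK le) iterD -sjk -iterD addnA subnK //.
  by rewrite addnC iterD s_mul.
have pk : (\prod_(l < k) t l) ^+ 2 = 1.
  have := d_prod dS 0%N k; rewrite add0n /d sk /= -[LHS]mul1r.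
  by move/(mulIf d0n)/esym.
exists (k + k)%N; first by case/andP: k3; lia.
apply: iter_return; first by rewrite iterD sk.
rewrite big_split_ord /= -[RHS]pk expr2; congr (_ * _).
by apply: eq_bigr => l _; rewrite addnC iterD sk.
Qed.
End Pairs.

Lemma iter_phi (K : fieldExtType rat) (c : rat) (x : K) (n : nat) :
  iter n (phi c) (Some x) = Some (iter n (fun z => z ^+ 2 + c%:A) x).
Proof. by elim: n => [|n /= ->]. Qed.

(** For alpha irrational, (t, d) returns with alpha because an element of
    Q + Q (alpha - beta) has unique coordinates. *)
Lemma conjugate_pair (K : fieldExtType rat) (c : rat) (alpha : K) (n : nat) :
    quadratic_field K -> let f := fun x : K => x ^+ 2 + c%:A in
    (0 < n)%N -> iter n f alpha = alpha -> f alpha != alpha ->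
  exists beta t0 d0, [/\ alpha + beta = t0%:A, (alpha - beta) ^+ 2 = d0%:A,
    d0 != 0 & iter n (trace_step c) (t0, d0) = (t0, d0)].
Proof.
move=> K2 f n0 an fixN.
have [/vlineP[x xE]|aN] := boolP (alpha \in 1%VS).
  have fE : f alpha = (x ^+ 2 + c)%:A.
    by rewrite /f xE scalerDl -[x%:A]/(in_alg K x) -rmorphXn.
  exists (f alpha), (x + (x ^+ 2 + c)), ((x - (x ^+ 2 + c)) ^+ 2).
  have hs : alpha + f alpha = (x + (x ^+ 2 + c))%:A by rewrite fE xE -scalerDl.
  have hd : (alpha - f alpha) ^+ 2 = ((x - (x ^+ 2 + c)) ^+ 2)%:A.
    by rewrite fE xE -scalerBl -[LHS]/(in_alg K _ ^+ 2) -rmorphXn.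
  split=> //.
    rewrite expf_neq0 // subr_eq0; apply: contra fixN => /eqP e.
    by rewrite fE -e xE.
  have [ps pd] := iter_pair c hs hd n.
  rewrite an -iterSr /= an -/(f alpha) hs hd in ps pd.
  rewrite [LHS]surjective_pairing; congr (_, _); exact/esym/(@alg_inj K).
have [u [v uv]] := quadratic_relation K2 aN.
pose beta := u%:A - alpha; pose d0 := u ^+ 2 + 4 * v.
have hs : alpha + beta = u%:A by rewrite /beta addrC subrK.
have hd : (alpha - beta) ^+ 2 = d0%:A.
  have -> : (alpha - beta) ^+ 2 = u%:A ^+ 2 + 4 * (alpha ^+ 2 - u%:A * alpha).
    by rewrite /beta; ring.
  rewrite uv addrAC subrr add0r /d0 -[4 : K](rmorph_nat (in_alg K) 4).
  by rewrite -[u%:A]/(in_alg K u) -[v%:A]/(in_alg K v) -rmorphXn -rmorphM -rmorphD.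
have alpha_rat (x y : rat) : y != 0 -> y%:A * (alpha - beta) = x%:A -> False.
  move=> y0 e; case/negP: aN; apply/vlineP; exists ((x / y + u) / 2).
  have two : (2 : K) = in_alg K 2 by rewrite (rmorph_nat (in_alg K) 2).
  have diff : alpha - beta = (x / y)%:A.
    by rewrite mulrC -scalerA -e mulr_algl scalerA mulVf // scale1r.
  apply: (@mulfI _ (2 : K)); first by rewrite two fmorph_eq0.
  have -> : 2 * ((x / y + u) / 2)%:A = (x / y)%:A + u%:A :> K.
    by rewrite two -[_%:A]/(in_alg K _) -rmorphM /= -scalerDl; congr (_ *: _); field.
  by rewrite -diff -hs; ring.
exists beta, u, d0; split=> //.
  apply/eqP => d00; move/eqP: hd; rewrite d00 scale0r sqrf_eq0 => /eqP ab.
  by apply: (@alpha_rat 0 1) => //; rewrite ab mulr0 scale0r.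
have [ps pd] := iter_pair c hs hd n; have := iter_diff c hs hd n.
rewrite an in ps pd *; set P := \prod_(l < n) _ => pn.
move: ps pd; case: (iter n _ (u, d0)) => un dn /= ps pd.
have P1 : P = 1.
  apply/eqP; rewrite -[_ == _]negbK eq_sym -subr_eq0; apply/negP => P1.
  apply: (@alpha_rat (un - u) (1 - P)) => //.
  rewrite !scalerBl scale1r -ps -hs mulrBl mul1r -pn; ring.
rewrite P1 scale1r mul1r in pn; congr (_, _); apply: (@alg_inj K).
  rewrite -ps -hs; congr (_ + _).
  by apply: oppr_inj; apply: (addrI alpha).
by rewrite -pd pn hd.
Qed.

Lemma log_height_le (R : realType) (c : rat) (M : nat) :
    Z.of_nat M = height_bound -> log_height R c <= 6 * ln 10 ->
  (`|numq c| <= M)%N /\ (`|denq c| <= M)%N.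
Proof.
move=> ME; have MR : M%:R = 10 ^+ 6 :> R.
  have : (M%:Z = 10 ^+ 6 :> int) by apply: (can_inj Z_of_intK); rewrite rmorphXn; exact: ME.
  by move/(congr1 (intr : int -> R)); rewrite rmorphXn.
rewrite /log_height; set m := Num.max _ _.
have m0 : 0 < m by rewrite /m lt_max orbC normr_gt0 denq_eq0.
have -> : 6 * ln 10 = ln (M%:R) :> R by rewrite MR lnXn // mulr_natl.
rewrite ler_ln ?posrE ?ltr0z //; last by rewrite MR exprn_gt0.
rewrite -[M%:R]/(M%:~R) ler_int /m ge_max => /andP[]; lia.
Qed.

Theorem proposition3 (R : realType) (K : fieldExtType rat) (D : int) (c : rat)
    (K_quadratic : quadratic_field K)
    (D_discriminant : is_discriminant K D)
    (D_bound : -4000 <= D <= 4000)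
    (c_bound : log_height R c <= 6 * ln 10) :
  ~ exists (alpha : option K) (n : nat),
      (6 < n)%N /\ has_exact_period (phi c) n alpha.
Proof.
case=> alpha [n [n_gt6 [n_gt0 alpha_n alpha_min]]].
case: alpha alpha_n alpha_min => [x|] x_n x_min; last first.
  by apply: (x_min 1%N) => //; rewrite (leq_trans _ n_gt6).
rewrite iter_phi in x_n; case: x_n => x_n.
have n_gt1 : (1 < n)%N by rewrite (leq_trans _ n_gt6).
have fx : x ^+ 2 + c%:A != x.
  by apply/eqP => e; apply: (x_min 1%N); rewrite // iter_phi /= e.
have [y [t0 [d0 [sum diff d0_neq0 s_n]]]] := conjugate_pair K_quadratic n_gt0 x_n fx.
have ME : Z.of_nat (Z.to_nat height_bound) = height_bound by rewrite Z2Nat.id.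
have [c_num c_den] := log_height_le ME c_bound.
have [m /andP[m_gt0 m_le6] x_m] :=
  short_period sum diff ME c_num c_den n_gt0 d0_neq0 s_n.
apply: (x_min m); last by rewrite iter_phi x_m.
by rewrite m_gt0 (leq_ltn_trans m_le6).
Qed.
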